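(* Let $\mathfrak{g}=\mathfrak{sl}_2(\mathbb{C})\ltimes V_5$ and let $k\ge 0$. Then $$H^k(\mathfrak{g},\mathfrak{g})\cong\begin{cases}\mathbb{C}, & \text{if } k=1,3,4,5,6,8,\\ 0, & \text{otherwise.}\end{cases}$$
   Context: $V_m$ denotes the irreducible $\mathfrak{sl}_2(\mathbb{C})$-module of dimension $m+1$. The semidirect product $\mathfrak{sl}_2(\mathbb{C})\ltimes V_m$ is the vector space $\mathfrak{sl}_2(\mathbb{C})\oplus V_m$ with Lie bracket $[(X,v),(Y,u)]=([X,Y],Xu-Yv)$. $H^k(\mathfrak{g},\mathfrak{g})$ denotes the $k$-th Lie algebra (Chevalley–Eilenberg) cohomology of $\mathfrak{g}$ with coefficients in the adjoint module. *)

(* Defs.v *)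
From HB Require Import structures.
From mathcomp Require Import all_boot all_algebra.
From mathcomp Require Import boolp functions reals.
From mathcomp Require Import complex ring.

Set Implicit Arguments.
Unset Strict Implicit.
Unset Printing Implicit Defensive.

Import GRing.Theory.
Local Open Scope ring_scope.

HB.mixin Record isLieAlgebra (F : comNzRingType) L of GRing.Lmodule F L := {
  lie : L -> L -> L;
  lie_linearl : forall y : L, linear (lie^~ y);
  lie_linearr : forall x : L, linear (lie x);
  lie_alt : forall x : L, lie x x = 0;
  lie_jacobi : forall x y z : L,
    lie x (lie y z) + lie y (lie z x) + lie z (lie x y) = 0
}.

#[short(type="lieAlgType")]
HB.structure Definition LieAlgebra (F : comNzRingType) :=
  {L of GRing.Lmodule F L & isLieAlgebra F L}.

HB.mixin Record isLieModule (F : comNzRingType) (L : lieAlgType F) M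
    of GRing.Lmodule F M := {
  lie_act : L -> M -> M;
  lie_act_linearl : forall v : M, linear (lie_act^~ v);
  lie_act_linearr : forall x : L, linear (lie_act x);
  lie_act_lie : forall (x y : L) (v : M),
    lie_act (lie x y) v = lie_act x (lie_act y v) - lie_act y (lie_act x v)
}.

#[short(type="lieModType")]
HB.structure Definition LieModule (F : comNzRingType) (L : lieAlgType F) :=
  {M of GRing.Lmodule F M & isLieModule F L M}.

#[short(type="lieModVectType")]
HB.structure Definition LieModVect (F : comNzRingType) (L : lieAlgType F) :=
  {M of Vector F M & isLieModule F L M}.

Section LieTheory.
Variables (F : comNzRingType) (L : lieAlgType F).
Implicit Types x y z : L.

Lemma lieDl x y z : lie (x + y) z = lie x z + lie y z.
Proof. by have := lie_linearl z 1 x y; rewrite !scale1r. Qed.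

Lemma lieDr x y z : lie z (x + y) = lie z x + lie z y.
Proof. by have := lie_linearr z 1 x y; rewrite !scale1r. Qed.

Lemma lie_anti x y : lie x y = - lie y x.
Proof.
have := lie_alt (x + y).
by rewrite lieDl !lieDr !lie_alt addr0 add0r => /eqP; rewrite addr_eq0 => /eqP.
Qed.

Lemma lieNr x y : lie x (- y) = - lie x y.
Proof.
have lie0 : lie x 0 = 0 by apply: (addrI (lie x 0)); rewrite -lieDr !addr0.
by apply/eqP; rewrite -addr_eq0 -lieDr addNr lie0.
Qed.

End LieTheory.

Definition adjoint (F : comNzRingType) (L : lieAlgType F) : Type := L.

Section Adjoint.
Variables (F : comNzRingType) (L : lieAlgType F).

HB.instance Definition _ := GRing.Lmodule.on (adjoint L).

Fact adjoint_act (x y : L) (v : adjoint L) :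
  lie (lie x y) v = lie x (lie y v) - lie y (lie x v) :> L.
Proof.
have /eqP := lie_jacobi x y (v : L).
rewrite (lie_anti v (lie x y)) subr_eq0 => /eqP <-.
by rewrite (lie_anti v x) lieNr.
Qed.

HB.instance Definition _ := isLieModule.Build F L (adjoint L)
  (@lie_linearl F L) (@lie_linearr F L) adjoint_act.

End Adjoint.

Section SpecialLinear.
Variables (F : comNzRingType) (n : nat).

Definition traceless : {pred 'M[F]_n} := fun A => \tr A == 0.

Fact traceless_submod : submod_closed traceless.
Proof.
split=> [|a A B]; rewrite !unfold_in /traceless ?mxtrace0 // => /eqP trA /eqP trB.
by rewrite mxtraceD mxtraceZ trA trB mulr0 addr0.
Qed.

HB.instance Definition _ :=
  GRing.isSubmodClosed.Build F 'M[F]_n traceless traceless_submod.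

Record sl : predArgType := Sl {slval :> 'M[F]_n; _ : slval \in traceless}.

HB.instance Definition _ := [isSub for slval].
HB.instance Definition _ := [Choice of sl by <:].
HB.instance Definition _ := [SubChoice_isSubZmodule of sl by <:].
HB.instance Definition _ := [SubZmodule_isSubLmodule of sl by <:].

Fact sl_lie_subproof (A B : sl) :
  slval A *m slval B - slval B *m slval A \in traceless.
Proof. by rewrite unfold_in /traceless raddfB /= mxtrace_mulC subrr. Qed.

Definition sl_lie (A B : sl) : sl := Sl (sl_lie_subproof A B).

Fact sl_lie_linearl (B : sl) : linear (sl_lie^~ B).
Proof.
move=> a A A'; apply: val_inj => /=.
by rewrite mulmxDl mulmxDr -scalemxAl -scalemxAr scalerBr opprD addrACA.
Qed.

Fact sl_lie_linearr (A : sl) : linear (sl_lie A).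
Proof.
move=> a B B'; apply: val_inj => /=.
by rewrite mulmxDl mulmxDr -scalemxAl -scalemxAr scalerBr opprD addrACA.
Qed.

Fact sl_lie_alt (A : sl) : sl_lie A A = 0.
Proof. by apply: val_inj; rewrite /= subrr. Qed.

Fact sl_lie_jacobi (A B C : sl) :
  sl_lie A (sl_lie B C) + sl_lie B (sl_lie C A) + sl_lie C (sl_lie A B) = 0.
Proof.
apply: val_inj => /=.
move: (slval A) (slval B) (slval C) => {}A {}B {}C.
rewrite !(mulmxBl, mulmxBr) !mulmxA !opprB.
set p1 := A *m B *m C; set p2 := A *m C *m B; set p3 := B *m A *m C.
set p4 := B *m C *m A; set p5 := C *m A *m B; set p6 := C *m B *m A.
apply/matrixP => i j; rewrite !mxE; ring.
Qed.

HB.instance Definition _ := isLieAlgebra.Build F sl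
  sl_lie_linearl sl_lie_linearr sl_lie_alt sl_lie_jacobi.

End SpecialLinear.

Definition semidirect (F : comNzRingType) (L : lieAlgType F) (M : lieModType L)
  : Type := (L * M)%type.

Section Semidirect.
Variables (F : comNzRingType) (L : lieAlgType F) (M : lieModType L).

HB.instance Definition _ := GRing.Lmodule.on (semidirect M).

Definition semidirect_lie (x y : semidirect M) : semidirect M :=
  (lie x.1 y.1, lie_act x.1 y.2 - lie_act y.1 x.2).

Fact semidirect_linearl (y : semidirect M) : linear (semidirect_lie^~ y).
Proof.
move=> a x x'; congr pair; first exact: lie_linearl.
rewrite /= lie_act_linearl lie_act_linearr /=.
by rewrite opprD addrACA -scalerBr.
Qed.

Fact semidirect_linearr (x : semidirect M) : linear (semidirect_lie x).
Proof.
move=> a y y'; congr pair; first exact: lie_linearr.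
rewrite /= lie_act_linearl lie_act_linearr /=.
by rewrite opprD addrACA -scalerBr.
Qed.

Fact semidirect_alt (x : semidirect M) : semidirect_lie x x = 0.
Proof. by rewrite /semidirect_lie lie_alt subrr. Qed.

Fact semidirect_jacobi (x y z : semidirect M) :
  semidirect_lie x (semidirect_lie y z) + semidirect_lie y (semidirect_lie z x)
  + semidirect_lie z (semidirect_lie x y) = 0.
Proof.
case: x y z => [x u] [y v] [z w]; congr pair; first exact: lie_jacobi.
have actB (a : L) (s t : M) : lie_act a (s - t) = lie_act a s - lie_act a t.
  by rewrite [s - t]addrC -scaleN1r lie_act_linearr scaleN1r addrC.
rewrite /= !actB !lie_act_lie !opprB.
have addBB (a b c : M) : a - b + (b - c) = a - c by rewrite addrA subrK.
rewrite [X in _ + X + _ = _]addrC (addrACA (_ - _) (_ - _) (_ - _)) !addBB.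
by rewrite addrACA !addBB subrr.
Qed.

HB.instance Definition _ := isLieAlgebra.Build F (semidirect M)
  semidirect_linearl semidirect_linearr semidirect_alt semidirect_jacobi.

End Semidirect.

Section Irreducible.
Variables (F : fieldType) (L : lieAlgType F) (V : lieModVectType L).

Definition lie_stable (W : {vspace V}) :=
  forall (x : L) (v : V), v \in W -> lie_act x v \in W.

Definition lie_irreducible :=
  fullv != 0%VS :> {vspace V}
  /\ forall W : {vspace V}, lie_stable W -> W = 0%VS \/ W = fullv.

End Irreducible.

(* V_m is unique up to isomorphism, so it is characterized, not constructed. *)
Definition is_irr_sl2_module (F : fieldType) (m : nat)
    (V : lieModVectType (sl F 2)) :=
  lie_irreducible V /\ \dim (fullv : {vspace V}) = m.+1.

(* The quotient of an lmodule by a submodule; the library only makes {quot S}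
   a Z-module. *)
Section LmoduleQuotient.
Import Quotient.
Local Open Scope quotient_scope.
Variables (F : pzRingType) (V : lmodType F) (S : submodClosed V).

(* An alias of S, so that closure under opposite, which follows from closure
   under scaling, can be declared. *)
Definition submod_pred : {pred V} := S.
HB.instance Definition _ :=
  GRing.isSubmodClosed.Build F V submod_pred (submodClosedP S).

Definition quotlmod : Type := {quot submod_pred}.
HB.instance Definition _ := GRing.Zmodule.on quotlmod.
HB.instance Definition _ := EqQuotient.on quotlmod.

Definition quotlmod_scale (a : F) (x : quotlmod) : quotlmod :=
  \pi_quotlmod (a *: repr x).

Fact quotlmod_scaleE (a : F) (v : V) :
  quotlmod_scale a (\pi_quotlmod v) = \pi_quotlmod (a *: v).
Proof.
have : repr (\pi_quotlmod v) - v \in submod_pred.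
  by rewrite (idealrBE submod_pred); apply/eqP; exact: (@reprK _ quotlmod).
by move=> /(rpredZ a); rewrite scalerBr (idealrBE submod_pred) => /eqP.
Qed.

Fact quotlmod_piD : {morph \pi_quotlmod : u v / u + v}.
Proof. exact: (@pi_add V submod_pred). Qed.

Fact quotlmod_scalerA (a b : F) (x : quotlmod) :
  quotlmod_scale a (quotlmod_scale b x) = quotlmod_scale (a * b) x.
Proof.
by rewrite -[x]reprK (quotlmod_scaleE b) (quotlmod_scaleE a) quotlmod_scaleE scalerA.
Qed.

Fact quotlmod_scale1r : left_id 1 quotlmod_scale.
Proof. by move=> x; rewrite -[x]reprK quotlmod_scaleE scale1r. Qed.

Fact quotlmod_scalerDr : right_distributive quotlmod_scale +%R.
Proof.
move=> a x y; rewrite -[x]reprK -[y]reprK -quotlmod_piD !quotlmod_scaleE.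
by rewrite scalerDr quotlmod_piD.
Qed.

Fact quotlmod_scalerDl (x : quotlmod) :
  {morph quotlmod_scale^~ x : a b / a + b}.
Proof.
by move=> a b; rewrite -[x]reprK !quotlmod_scaleE scalerDl quotlmod_piD.
Qed.

HB.instance Definition _ := GRing.Zmodule_isLmodule.Build F quotlmod
  quotlmod_scalerA quotlmod_scale1r quotlmod_scalerDr quotlmod_scalerDl.

End LmoduleQuotient.

Section ChevalleyEilenberg.
Variables (F : comNzRingType) (L : lieAlgType F) (M : lieModType L).

Definition setarg k (x : 'I_k -> L) (i : 'I_k) (u : L) : 'I_k -> L :=
  fun j => if j == i then u else x j.

(* The k-cochains, i.e. the alternating k-linear maps L^k -> M. *)
Definition is_cochain k (w : ('I_k -> L) -> M) :=
  (forall (x : 'I_k -> L) (i : 'I_k), linear (fun u => w (setarg x i u)))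
  /\ (forall (x : 'I_k -> L) (i j : 'I_k), i != j -> x i = x j -> w x = 0).

(* The family [x_i, x_j], x_0, ..., x_k with x_i and x_j left out. *)
Definition lie_args k (x : 'I_k.+1 -> L) (i j : 'I_k.+1) : 'I_k -> L :=
  nth 0 (lie (x i) (x j) ::
         [seq x l | l <- enum 'I_k.+1 & (l != i) && (l != j)]).

(* Both signs are for indices starting at 0. The differential is defined on all
   functions, so that no proof that it preserves cochains is needed. *)
Definition ce_diff k (w : ('I_k -> L) -> M) (x : 'I_k.+1 -> L) : M :=
  \sum_(i < k.+1) (-1) ^+ i *: lie_act (x i) (w (x \o lift i))
  + \sum_(i < k.+1) \sum_(j < k.+1 | (i < j)%N)
      (-1) ^+ (i + j) *: w (lie_args x i j).

(* There is no (-1)-cochain, so only 0 is a coboundary in degree 0. *)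
Definition is_coboundary k : (('I_k -> L) -> M) -> Prop :=
  match k with
  | 0 => fun w => w = 0
  | k'.+1 => fun w => exists2 u, is_cochain u & ce_diff (k := k') u = w
  end.

Fact ce_diff_linear k : linear (@ce_diff k).
Proof.
move=> a w w'; apply/funext => x.
have -> : (a *: ce_diff w + ce_diff w') x = a *: ce_diff w x + ce_diff w' x.
  by [].
rewrite /ce_diff scalerDr [RHS]addrACA; congr (_ + _).
  rewrite scaler_sumr -big_split /=; apply: eq_bigr => i _.
  by rewrite lie_act_linearr scalerDr !scalerA mulrC.
rewrite scaler_sumr -big_split /=; apply: eq_bigr => i _.
rewrite scaler_sumr -big_split /=; apply: eq_bigr => j _.
by rewrite scalerDr !scalerA mulrC.
Qed.

Fact is_cochain0 k : is_cochain (0 : ('I_k -> L) -> M).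
Proof. by split=> // x i a u v; rewrite /GRing.zero /= scaler0 addr0. Qed.

Fact is_cochain_linear k a (w w' : ('I_k -> L) -> M) :
  is_cochain w -> is_cochain w' -> is_cochain (a *: w + w').
Proof.
have appE x : (a *: w + w') x = a *: w x + w' x by [].
move=> [wlin walt] [w'lin w'alt]; split=> [x i b u v|x i j neq_ij eq_x].
  by rewrite !appE wlin w'lin !scalerDr !scalerA mulrC addrACA.
by rewrite appE (walt x i j) // (w'alt x i j) // scaler0 addr0.
Qed.

Definition cocycle_pred k : {pred ('I_k -> L) -> M} :=
  fun w => `[< is_cochain w /\ ce_diff w = 0 >].

Fact cocycle_submod k : submod_closed (@cocycle_pred k).
Proof.
split=> [|a w w'].
  apply/asboolP; split; first exact: is_cochain0.
  by have := ce_diff_linear (k := k) (-1) 0 0; rewrite !scaleN1r !addNr.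
move=> /asboolP[wC dw0] /asboolP[w'C dw'0]; apply/asboolP; split.
  exact: is_cochain_linear.
by rewrite ce_diff_linear dw0 dw'0 scaler0 addr0.
Qed.

HB.instance Definition _ k := GRing.isSubmodClosed.Build F
  (('I_k -> L) -> M) (@cocycle_pred k) (@cocycle_submod k).

Record cocycle k : predArgType := Cocycle {
  cocycle_val :> ('I_k -> L) -> M;
  _ : cocycle_val \in @cocycle_pred k
}.

HB.instance Definition _ k := [isSub for @cocycle_val k].
HB.instance Definition _ k := [Choice of cocycle k by <:].
HB.instance Definition _ k := [SubChoice_isSubZmodule of cocycle k by <:].
HB.instance Definition _ k := [SubZmodule_isSubLmodule of cocycle k by <:].

(* The coboundaries are taken inside the type of cocycles, so the quotient does
   not depend on a proof that ce_diff squares to 0. *)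
Definition coboundary_pred k : {pred cocycle k} :=
  fun w => `[< is_coboundary (cocycle_val w) >].

Fact coboundary_submod k : submod_closed (@coboundary_pred k).
Proof.
split=> [|a w w']; rewrite !unfold_in.
  apply/asboolP; case: k => [//|k] /=.
  exists 0; first exact: is_cochain0.
  by have := ce_diff_linear (k := k) (-1) 0 0; rewrite !scaleN1r !addNr.
move=> /asboolP wB /asboolP w'B; apply/asboolP; move: w w' wB w'B.
case: k => [|k] w w' /=; first by move=> -> ->; rewrite scaler0 addr0.
move=> [u uC <-] [u' u'C <-]; exists (a *: u + u').
  exact: is_cochain_linear.
exact: ce_diff_linear.
Qed.

HB.instance Definition _ k := GRing.isSubmodClosed.Build F
  (cocycle k) (@coboundary_pred k) (@coboundary_submod k).

Definition coboundaries k : submodClosed (cocycle k) := @coboundary_pred k.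

Definition cohomology k : lmodType F := quotlmod (coboundaries k).

End ChevalleyEilenberg.

Definition lmod_iso (F : pzRingType) (U W : lmodType F) :=
  exists f : {linear U -> W}, bijective f.

(* Main.v *)
From HB Require Import structures.
Require Import Defs.
From Stdlib Require Import ZArith.
From mathcomp Require Import all_boot all_algebra.
From mathcomp Require Import boolp functions reals complex.
From mathcomp Require Import ring ssrZ zify.

(** The Chevalley-Eilenberg complex of g = sl_2 |x V_5 with values in g has
    total dimension 9 * 2^9, so its cohomology can be computed; the proof
    arranges the computation so that only a small part of it is numerical.

    Cochains are treated as functions on lists of vectors. In this form the
    differential is defined by recursion on the list, the recursion being
    Cartan's formula: i_x d + d i_x is the action of x (list_diff; ce_diffE
    identifies it with the alternating sum of the definition).

    The element h of sl_2 acts diagonally in the basis e, h, f, w_0, ..., w_5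
    of g, where the w_i are weight vectors of V_5. By Cartan's formula the
    contraction by h, divided by the weight, is a contracting homotopy of the
    part of the complex of nonzero weight. Hence every cocycle is cohomologous
    to one of weight zero (weight0_reduction), where the complex has only 340
    basis elements in all.

    There, Gauss-Jordan elimination on the integer matrices of the differential
    d gives integer matrices H and, in each degree, a cochain z and a linear
    form phi, such that
         N^2 = N (d H + H d) + z phi,   d z = 0,   phi d = 0,
    with N a common denominator, and with phi (z) = N^2 in degrees 1, 3, 4, 5,
    6, 8 and phi = 0 in the others. These identities are checked by
    evaluation (certificate). So a cocycle is a coboundary if and only if phi
    vanishes on it, and phi identifies the cohomology with the field or with 0
    (cohomology_of_adapted_basis).

    It remains to find such a basis of g for a module V of which only
    irreducibility and the dimension are known: for a vector v killed by e, the
    w_i = f^i v / i! span a submodule, hence V, and the dimension forces the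
    weight of v (sl2_weight_basis).

    The degrees follow the pattern of the Hochschild-Serre theorem: the
    cohomology is that of sl_2, which is one-dimensional in degrees 0 and 3,
    tensored with the sl_2-invariants of H^j(V, g), which are one-dimensional
    for j = 1, 3, 5 and zero otherwise. *)

Set Implicit Arguments.
Unset Strict Implicit.
Unset Printing Implicit Defensive.

Import GRing.Theory Num.Theory.
Local Open Scope ring_scope.
Delimit Scope Z_scope with Z.

(** * Alternating cochains as functions on lists *)

Section ListCochains.
Variables (F : comNzRingType) (L : lieAlgType F) (M : lieModType L).
Implicit Types (W U : seq L -> M) (x y : L) (s : seq L) (k : nat).

(** Fixing the first argument at each step makes contraction by a vector, that
    is [fun s => W (x :: s)], stay inside the notion, and every proof below an
    induction on the degree. The values on lists of other lengths are arbitrary.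
    The three clauses imply that exchanging the first two arguments changes the
    sign (alternating_swap) and that W vanishes as soon as the first argument
    occurs twice (alternating_mem). *)
Fixpoint alternating k W : Prop :=
  if k is k'.+1 then
    [/\ forall s, size s = k' -> linear (fun x => W (x :: s)),
        forall x, alternating k' (fun s => W (x :: s))
      & forall x s, (size s).+1 = k' -> W (x :: x :: s) = 0]
  else True.

(** The action of x on the arguments of W: the derivation part of the Lie
    derivative along x. *)
Fixpoint subst_sum x W s : M :=
  if s is y :: s' then
    W (lie x y :: s') + subst_sum x (fun t => W (y :: t)) s'
  else 0.

(** Cartan's formula d W (x, s) = (L_x W) (s) - d (i_x W) (s), read as a
    recursive definition. *)
Fixpoint list_diff W s : M :=
  if s is x :: s' then
    lie_act x (W s') - subst_sum x W s' - list_diff (fun t => W (x :: t)) s'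
  else 0.

Lemma lie_actDr x u v : lie_act x (u + v) = lie_act x u + lie_act x v :> M.
Proof. by have := lie_act_linearr x 1 u v; rewrite !scale1r. Qed.

Lemma lie_act0r x : lie_act x 0 = 0 :> M.
Proof. by apply: (addrI (lie_act x 0)); rewrite -lie_actDr !addr0. Qed.

Lemma lie_actZr x a u : lie_act x (a *: u) = a *: lie_act x u :> M.
Proof. by have := lie_act_linearr x a u 0; rewrite !addr0 lie_act0r addr0. Qed.

Lemma eq_subst_sum x W U s :
  (forall t, size t = size s -> W t = U t) -> subst_sum x W s = subst_sum x U s.
Proof.
elim: s W U => //= y s IH W U eqWU; rewrite eqWU //; congr (_ + _).
by apply: IH => t szt; apply: eqWU; rewrite /= szt.
Qed.

Lemma eq_list_diff W U s :
  (forall t, (size t).+1 = size s -> W t = U t) -> list_diff W s = list_diff U s.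
Proof.
elim: s W U => //= x s IH W U eqWU; congr (lie_act x _ - _ - _).
- exact: eqWU.
- by apply: eq_subst_sum => t szt; apply: eqWU; rewrite szt.
- by apply: IH => t szt; apply: eqWU; rewrite /= szt.
Qed.

Lemma subst_sum_linear a W U x s :
  subst_sum x (fun t => a *: W t + U t) s
    = a *: subst_sum x W s + subst_sum x U s.
Proof.
elim: s W U => /= [|y s IH] W U; first by rewrite scaler0 addr0.
by rewrite (IH (fun t => W (y :: t))) scalerDr addrACA.
Qed.

Fact addrBBACA (V : zmodType) (x x' y y' z z' : V) :
  (x + x') - (y + y') - (z + z') = (x - y - z) + (x' - y' - z').
Proof. by rewrite (opprD y) (opprD z) (addrACA x) (addrACA (x - y)). Qed.

Lemma list_diff_linear a W U s :
  list_diff (fun t => a *: W t + U t) s = a *: list_diff W s + list_diff U s.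
Proof.
elim: s W U => /= [|x s IH] W U; first by rewrite scaler0 addr0.
rewrite (IH (fun t => W (x :: t))) subst_sum_linear lie_actDr lie_actZr.
by rewrite addrBBACA !scalerBr.
Qed.

Lemma subst_sum0 x s : subst_sum x (fun=> 0) s = 0.
Proof. by elim: s => //= y s ->; rewrite addr0. Qed.

Lemma list_diff0 s : list_diff (fun=> 0) s = 0.
Proof. by elim: s => //= x s ->; rewrite lie_act0r subst_sum0 !subr0. Qed.

Lemma eq_alternating k W U :
  (forall t, size t = k -> W t = U t) -> alternating k W -> alternating k U.
Proof.
elim: k W U => //= k IH W U eqWU [linW altW W0]; split.
- by move=> s szs a x y; rewrite -!eqWU /= ?szs // linW.
- by move=> x; apply: IH (altW x) => t szt; apply: eqWU; rewrite /= szt.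
- by move=> x s szs; rewrite -eqWU /= ?szs // W0.
Qed.

Lemma alternating_linear k a W U :
  alternating k W -> alternating k U ->
  alternating k (fun s => a *: W s + U s).
Proof.
elim: k W U => //= k IH W U [linW altW W0] [linU altU U0]; split.
- move=> s szs b x y; rewrite linW // linU // !scalerDr !scalerA mulrC.
  by rewrite addrACA.
- by move=> x; apply: IH.
- by move=> x s szs; rewrite W0 // U0 // scaler0 addr0.
Qed.

Lemma alternating0 k : alternating k (fun=> 0).
Proof.
by elim: k => //= k IH; split=> // s _ a x y; rewrite scaler0 addr0.
Qed.

Lemma alternatingD k W U :
  alternating k W -> alternating k U -> alternating k (fun s => W s + U s).
Proof.
move=> altW altU; apply: eq_alternating (alternating_linear 1 altW altU).
by move=> t _; rewrite scale1r.
Qed.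

Lemma alternatingZ k a W : alternating k W -> alternating k (fun s => a *: W s).
Proof.
move=> altW; apply: eq_alternating (alternating_linear a altW (alternating0 k)).
by move=> t _; rewrite addr0.
Qed.

Lemma alternatingB k W U :
  alternating k W -> alternating k U -> alternating k (fun s => W s - U s).
Proof.
move=> altW altU; apply: eq_alternating (alternating_linear (-1) altU altW).
by move=> t _; rewrite scaleN1r addrC.
Qed.

Lemma alternating_act k x W :
  alternating k W -> alternating k (fun s => lie_act x (W s)).
Proof.
elim: k W => //= k IH W [linW altW W0]; split.
- by move=> s szs a y z; rewrite linW // lie_actDr lie_actZr.
- by move=> y; apply: IH.
- by move=> y s szs; rewrite W0 // lie_act0r.
Qed.

Section Head.
Variables (k : nat) (W : seq L -> M).
Hypothesis altW : alternating k.+1 W.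

Lemma alternating_headD x y s : size s = k -> W (x + y :: s) = W (x :: s) + W (y :: s).
Proof. by case: altW => lin _ _ szs; have := lin s szs 1 x y; rewrite !scale1r. Qed.

Lemma alternating_head0 s : size s = k -> W (0 :: s) = 0.
Proof.
by move=> szs; apply: (addrI (W (0 :: s))); rewrite -alternating_headD // !addr0.
Qed.

Lemma alternating_headZ a x s : size s = k -> W (a *: x :: s) = a *: W (x :: s).
Proof.
case: altW => lin _ _ szs; have := lin s szs a x 0.
by rewrite addr0 alternating_head0 // addr0.
Qed.

End Head.

Lemma alternating_swap k W x y s :
  alternating k.+2 W -> size s = k -> W (x :: y :: s) = - W (y :: x :: s).
Proof.
move=> altW szs; have [_ altW1 W0] := altW.
have szs1 z : size (z :: s) = k.+1 by rewrite /= szs.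
have W00 z : W (z :: z :: s) = 0 by apply: W0; rewrite szs.
apply/eqP; rewrite -addr_eq0; apply/eqP.
have := W00 (x + y); rewrite (alternating_headD altW) //.
have /= -> := @alternating_headD k (fun t => W (x :: t)) (altW1 x) x y s szs.
have /= -> := @alternating_headD k (fun t => W (y :: t)) (altW1 y) x y s szs.
by rewrite !W00 add0r addr0.
Qed.

Lemma alternating_mem k W x s :
  alternating k.+1 W -> size s = k -> x \in s -> W (x :: s) = 0.
Proof.
elim: s k W => // y s IH [//|k] W altW [szs]; rewrite inE.
have [_ altW1 W0] := altW.
case: eqP => [-> _|_ /= xs]; first by apply: W0; rewrite szs.
rewrite (alternating_swap _ _ altW) //.
by rewrite (IH k (fun t => W (y :: t))) // oppr0.
Qed.

Lemma alternating_subst_sum k x W :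
  alternating k W -> alternating k (subst_sum x W).
Proof.
elim: k W => //= k IH W altW; have [linW altW1 W0] := altW; split.
- move=> s szs a y z.
  have -> : lie x (a *: y + z) = a *: lie x y + lie x z by apply: lie_linearr.
  rewrite linW // (@eq_subst_sum _ _ (fun t => a *: W (y :: t) + W (z :: t))).
    by rewrite subst_sum_linear scalerDr addrACA.
  by move=> t szt; rewrite linW // szt.
- by move=> y; apply: alternatingD; [exact: altW1|exact: IH].
- move=> y s szs; rewrite -{k}szs in altW altW1 W0 linW IH *.
  rewrite (alternating_swap _ _ altW) // addrA addNr add0r.
  rewrite (@eq_subst_sum _ _ (fun=> 0)) ?subst_sum0 // => t szt.
  by apply: W0; rewrite szt.
Qed.

Lemma subst_sum_linear_arg k W a x y s :
  alternating k W -> size s = k ->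
  subst_sum (a *: x + y) W s = a *: subst_sum x W s + subst_sum y W s.
Proof.
elim: s k W => [|z s IH] [|k] W //=; first by rewrite scaler0 addr0.
move=> [linW altW1 _] [szs].
have -> : lie (a *: x + y) z = a *: lie x z + lie y z by apply: lie_linearl.
by rewrite linW // (IH k) // scalerDr addrACA.
Qed.

(** By induction the contraction of d W by any vector is alternating, as a
    difference of a Lie derivative and the differential of a contraction. Two
    equal leading arguments x, x give L_x (i_x W) - L_x (i_x W) + d (i_x i_x W),
    since L_x commutes with i_x. *)
Theorem alternating_list_diff k W :
  alternating k W -> alternating k.+1 (list_diff W).
Proof.
elim: k W => [|k IH] W altW; split.
- move=> [|//] _ a x y /=; rewrite !subr0; exact: lie_act_linearl.
- by [].
- by [].
- have [linW altW1 _] := altW.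
  move=> s szs a x y /=.
  rewrite lie_act_linearl (subst_sum_linear_arg _ _ _ altW) //.
  rewrite (@eq_list_diff _ (fun t => a *: W (x :: t) + W (y :: t))).
    by rewrite list_diff_linear addrBBACA !scalerBr.
  by move=> t; rewrite szs => -[szt]; rewrite linW.
- move=> x; have [_ altW1 _] := altW.
  apply: (@alternatingB _ (fun s => lie_act x (W s) - subst_sum x W s)).
    by apply: alternatingB; [exact: alternating_act|exact: alternating_subst_sum].
  exact: (IH (fun t => W (x :: t)) (altW1 x)).
- move=> x s [szs] /=; have [_ altW1 W0] := altW.
  rewrite lie_alt (alternating_head0 altW) // add0r.
  rewrite (@eq_list_diff _ (fun=> 0)) => [|t szt].
    by rewrite list_diff0 subr0 subrr.
  by apply: W0; rewrite szt szs.
Qed.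

Lemma alternating_list_diff_pred k W :
  alternating k.-1 W -> alternating k (list_diff W).
Proof. by case: k => // k; apply: alternating_list_diff. Qed.

End ListCochains.

(** * Comparison with cochains on families and their differential *)

Section Bridge.
Variables (F : comNzRingType) (L : lieAlgType F) (M : lieModType L).
Implicit Types (W U : seq L -> M) (u v : L) (s : seq L) (k : nat).

Definition args k (x : 'I_k -> L) : seq L := [seq x i | i <- enum 'I_k].

Definition list_cochain k (w : ('I_k -> L) -> M) s : M :=
  w (fun i => nth 0 s i).

Definition fun_cochain k W : ('I_k -> L) -> M := fun x => W (args x).

Definition cons_arg k u (x : 'I_k -> L) : 'I_k.+1 -> L :=
  fun i => if unlift ord0 i is Some j then x j else u.

Lemma size_args k (x : 'I_k -> L) : size (args x) = k.
Proof. by rewrite size_map size_enum_ord. Qed.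

Lemma nth_args k (x : 'I_k -> L) : (fun i : 'I_k => nth 0 (args x) i) = x.
Proof.
apply/funext => i; rewrite (nth_map i) ?size_enum_ord //.
by rewrite nth_ord_enum.
Qed.

Lemma args_nth k s : size s = k -> args (fun i : 'I_k => nth 0 s i) = s.
Proof.
move=> szs; apply: (@eq_from_nth _ 0); rewrite size_args // => i ltik.
exact: (congr1 (@^~ (Ordinal ltik)) (nth_args (fun i : 'I_k => nth 0 s i))).
Qed.

Lemma args_cons k (x : 'I_k.+1 -> L) : args x = x ord0 :: args (x \o lift ord0).
Proof. by rewrite /args enum_ordSl /= -map_comp. Qed.

Lemma cons_arg0 k u (x : 'I_k -> L) : cons_arg u x ord0 = u.
Proof. by rewrite /cons_arg unlift_none. Qed.

Lemma cons_arg_lift k u (x : 'I_k -> L) i : cons_arg u x (lift ord0 i) = x i.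
Proof. by rewrite /cons_arg liftK. Qed.

Lemma cons_arg_nth k u s :
  cons_arg u (fun i : 'I_k => nth 0 s i) = fun i => nth 0 (u :: s) i.
Proof.
apply/funext => i; case: (unliftP ord0 i) => [j ->|->].
  by rewrite cons_arg_lift.
by rewrite cons_arg0.
Qed.

Lemma args_cons_arg k u (x : 'I_k -> L) : args (cons_arg u x) = u :: args x.
Proof.
rewrite args_cons cons_arg0; congr (_ :: args _).
by apply/funext => i; rewrite /= cons_arg_lift.
Qed.

Lemma setarg_cons k u v (x : 'I_k -> L) i :
  setarg (cons_arg u x) (lift ord0 i) v = cons_arg u (setarg x i v).
Proof.
apply/funext => j; rewrite /setarg; case: (unliftP ord0 j) => [l ->|->].
  by rewrite !cons_arg_lift (inj_eq lift_inj).
by rewrite !cons_arg0.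
Qed.

Lemma setarg0 k u v (x : 'I_k -> L) : setarg (cons_arg u x) ord0 v = cons_arg v x.
Proof.
apply/funext => j; rewrite /setarg; case: (unliftP ord0 j) => [l ->|->].
  by rewrite !cons_arg_lift.
by rewrite !cons_arg0.
Qed.

Lemma is_cochain_cons k (w : ('I_k.+1 -> L) -> M) u :
  is_cochain w -> is_cochain (fun x => w (cons_arg u x)).
Proof.
case=> linw w0; split=> [x i a v v'|x i j neq_ij eq_xij].
  by rewrite -!setarg_cons; apply: linw.
apply: (w0 _ (lift ord0 i) (lift ord0 j)); first by rewrite (inj_eq lift_inj).
by rewrite !cons_arg_lift.
Qed.

Lemma alternating_list_cochain k (w : ('I_k -> L) -> M) :
  is_cochain w -> alternating k (list_cochain w).
Proof.
elim: k w => //= k IH w cow; split.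
- move=> s szs a u v; have [linw _] := cow.
  have := linw (cons_arg 0 (fun i : 'I_k => nth 0 s i)) ord0 a u v.
  by rewrite !setarg0 !cons_arg_nth.
- move=> u; apply: eq_alternating (IH _ (is_cochain_cons u cow)) => s _.
  by rewrite /list_cochain cons_arg_nth.
- move=> u s; have [_ w0] := cow.
  case: k w {IH cow} w0 => // k w w0 _.
  by apply: (w0 _ ord0 (lift ord0 ord0)).
Qed.

Lemma is_cochain_fun k W : alternating k W -> is_cochain (@fun_cochain k W).
Proof.
elim: k W => [|k IH] W; first by split=> x [].
move=> altW; have [linW altW1 W0] := altW.
have eqc (x : 'I_k.+1 -> L) : x = cons_arg (x ord0) (x \o lift ord0).
  apply/funext => i; case: (unliftP ord0 i) => [j ->|->].
    by rewrite cons_arg_lift.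
  by rewrite cons_arg0.
split=> [x i a u v|x i j].
  rewrite {}[x]eqc; move: (x ord0) (x \o lift ord0) => {}u0 {}x.
  rewrite /fun_cochain; case: (unliftP ord0 i) => [j ->|->].
    rewrite !setarg_cons !args_cons_arg; have [lin1 _] := IH _ (altW1 u0).
    exact: lin1.
  by rewrite !setarg0 !args_cons_arg linW ?size_args.
rewrite {}[x]eqc; move: (x ord0) (x \o lift ord0) => {}u0 {}x.
rewrite /fun_cochain args_cons_arg.
have mem l : x l \in args x by apply: map_f; rewrite mem_enum.
case: (unliftP ord0 i) => [i' ->|->]; case: (unliftP ord0 j) => [j' ->|->].
- rewrite (inj_eq lift_inj) !cons_arg_lift; have [_ alt1] := IH _ (altW1 u0).
  exact: alt1.
- rewrite cons_arg_lift cons_arg0 => _ eqx.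
  by rewrite (alternating_mem altW) ?size_args // -eqx.
- rewrite cons_arg_lift cons_arg0 => _ eqx.
  by rewrite (alternating_mem altW) ?size_args // eqx.
- by rewrite eqxx.
Qed.

Definition drop_arg k (x : 'I_k -> L) (j : 'I_k) : seq L :=
  [seq x l | l <- enum 'I_k & l != j].

Lemma drop_arg0 k (x : 'I_k.+1 -> L) : drop_arg x ord0 = args (x \o lift ord0).
Proof.
rewrite /drop_arg enum_ordSl /= filter_map -map_comp.
by rewrite (eq_filter (a2 := predT)) ?filter_predT // => i /=.
Qed.

Lemma drop_arg_lift k (x : 'I_k.+1 -> L) j :
  drop_arg x (lift ord0 j) = x ord0 :: drop_arg (x \o lift ord0) j.
Proof.
rewrite /drop_arg enum_ordSl /= filter_map -map_comp; congr (_ :: map _ _).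
Qed.

Lemma size_drop_arg k (x : 'I_k -> L) j : (size (drop_arg x j)).+1 = k.
Proof.
elim: k x j => [|k IH] x j; first by case: j.
case: (unliftP ord0 j) => [i ->|->]; last by rewrite drop_arg0 size_args.
by rewrite drop_arg_lift /= IH.
Qed.

(** The bracket [u, x_j] sits in place j in the recursive sum and in front in
    the alternating sum; moving it costs the sign (-1) ^ j. *)
Lemma subst_sumE k W u (x : 'I_k -> L) :
  alternating k W ->
  subst_sum u W (args x)
    = \sum_(j < k) (-1) ^+ j *: W (lie u (x j) :: drop_arg x j).
Proof.
elim: k W x => [|k IH] W x altW; first by rewrite /args enum_ord0 big_ord0.
rewrite args_cons big_ord_recl /= drop_arg0 expr0 scale1r; congr (_ + _).
have [_ altW1 _] := altW; rewrite (IH (fun t => W (x ord0 :: t)) _ (altW1 _)).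
apply: eq_bigr => j _; rewrite drop_arg_lift exprS mulN1r scaleNr.
case: k j altW {IH altW1} x => [[]//|k] j altW x.
rewrite (alternating_swap _ _ altW) ?scalerN //.
by have [] := size_drop_arg (x \o lift ord0) j.
Qed.

Definition drop_arg2 k (x : 'I_k -> L) (i j : 'I_k) : seq L :=
  [seq x l | l <- enum 'I_k & (l != i) && (l != j)].

Lemma size_drop_arg2 k (x : 'I_k -> L) (i j : 'I_k) :
  i != j -> (size (drop_arg2 x i j)).+2 = k.
Proof.
move=> neq_ij; rewrite size_map.
have -> : size [seq l <- enum 'I_k | (l != i) && (l != j)] = #|predC (pred2 i j)|.
  rewrite size_filter enumT cardE /enum_mem size_filter; apply: eq_count => l.
  by rewrite !inE negb_or.
by have := cardC (pred2 i j); rewrite card2 neq_ij card_ord !addSn add0n.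
Qed.

Lemma drop_arg2_lift k (x : 'I_k.+1 -> L) i j :
  drop_arg2 x (lift ord0 i) (lift ord0 j)
    = x ord0 :: drop_arg2 (x \o lift ord0) i j.
Proof. by rewrite /drop_arg2 enum_ordSl /= filter_map -map_comp. Qed.

Lemma fun_cochain_lie_args k W (x : 'I_k.+1 -> L) (i j : 'I_k.+1) :
  i != j ->
  fun_cochain W (lie_args x i j) = W (lie (x i) (x j) :: drop_arg2 x i j).
Proof.
move=> neq_ij; rewrite /fun_cochain args_nth //=.
by have [] := size_drop_arg2 x neq_ij.
Qed.

(** The terms of the alternating sum in which the first argument is acting
    give the Lie derivative. In all the others the first argument is passive;
    they form the differential of the contraction, with one sign change from
    the shift of indices. *)
Lemma ce_diffE k W (x : 'I_k.+1 -> L) :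
  alternating k W -> ce_diff (fun_cochain W) x = list_diff W (args x).
Proof.
elim: k W x => [|k IH] W x altW.
  rewrite /ce_diff [X in _ + X]big1 ?addr0; last first.
    by move=> i _; apply: big_pred0 => j; rewrite !ord1.
  rewrite big_ord_recl big_ord0 args_cons /= expr0 scale1r addr0.
  by rewrite /fun_cochain /args !enum_ord0 /= subr0 subr0.
have [_ altW1 _] := altW; pose x' : 'I_k.+1 -> L := x \o lift ord0.
rewrite args_cons /= -/x' -(IH _ _ (altW1 _)) (subst_sumE _ _ altW).
rewrite /ce_diff big_ord_recl expr0 scale1r -!addrA; congr (_ + _).
rewrite [X in _ + X = _]big_ord_recl opprD [RHS]addrCA; congr (_ + _).
  rewrite -sumrN; apply: eq_bigr => i _.
  rewrite exprS mulN1r scaleNr /fun_cochain args_cons.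
  congr (- (_ *: lie_act _ (W (_ :: _)))).
    by rewrite /=; congr x; apply/val_inj.
  rewrite /args; apply: eq_map => l /=; congr x; apply/val_inj.
  by rewrite /= /bump !add1n ltnS addnS.
congr (_ + _).
  rewrite big_mkcond big_ord_recl /= add0r -sumrN; apply: eq_bigr => j _.
  rewrite /= add0n exprS mulN1r scaleNr; congr (- (_ *: W _)).
  rewrite args_nth.
    congr (_ :: _); rewrite enum_ordSl /= filter_map -map_comp.
    by congr map; apply: eq_filter => l /=; rewrite (inj_eq lift_inj).
  rewrite /= enum_ordSl /= filter_map !size_map.
  rewrite -[RHS](size_drop_arg x' j) size_map; congr (size _).+1.
rewrite -sumrN; apply: eq_bigr => i _.
rewrite big_mkcond big_ord_recl /= add0r -sumrN [RHS]big_mkcond /=.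
apply: eq_bigr => j _; rewrite /bump /= !add1n ltnS; case: ifP => // ltij.
have neq_ij : i != j by rewrite neq_ltn ltij.
rewrite !fun_cochain_lie_args ?(inj_eq lift_inj) // drop_arg2_lift.
rewrite -scalerN; congr (_ *: _).
  by rewrite addSn addnS !exprS mulrA mulrNN !mul1r.
case: k x @x' altW i j ltij neq_ij {IH altW1} => [|k] x x' altW i j ltij neq_ij.
  by rewrite !ord1 in ltij.
rewrite (alternating_swap _ _ altW) //.
by have [] := size_drop_arg2 (x \o lift ord0) neq_ij.
Qed.

End Bridge.

(** * Wedge product with a linear form *)

Section Wedge.
Variables (F : comNzRingType) (L : lieAlgType F) (M : lieModType L).
Implicit Types (W U : seq L -> M) (u v x : L) (s : seq L) (k : nat).

(** The exterior product of a linear form and a cochain, by the rule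
    i_x (phi /\ U) = phi (x) U - phi /\ (i_x U). *)
Fixpoint wedge (phi : L -> F) U s : M :=
  if s is x :: s' then phi x *: U s' - wedge phi (fun t => U (x :: t)) s' else 0.

Lemma eq_wedge phi W U s :
  (forall t, (size t).+1 = size s -> W t = U t) -> wedge phi W s = wedge phi U s.
Proof.
elim: s W U => //= x s IH W U eqWU; congr (_ *: _ - _); first exact: eqWU.
by apply: IH => t szt; apply: eqWU; rewrite /= szt.
Qed.

Lemma wedge_linear phi a W U s :
  wedge phi (fun t => a *: W t + U t) s = a *: wedge phi W s + wedge phi U s.
Proof.
elim: s W U => /= [|x s IH] W U; first by rewrite scaler0 addr0.
rewrite (IH (fun t => W (x :: t))) scalerDr opprD addrACA scalerBr.
by rewrite !scalerA mulrC.
Qed.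

Lemma wedge0 phi s : wedge phi (fun=> 0) s = 0.
Proof. by elim: s => //= x s ->; rewrite scaler0 subrr. Qed.

Lemma alternating_wedge phi k U :
  (forall a x y, phi (a *: x + y) = a * phi x + phi y) ->
  alternating k U -> alternating k.+1 (wedge phi U).
Proof.
move=> lin; elim: k U => [|k IH] U altU; split.
- by move=> [|//] _ a x y /=; rewrite !subr0 lin scalerDl scalerA.
- by [].
- by [].
- move=> s szs a x y /=; have [linU _ _] := altU.
  rewrite (@eq_wedge _ _ (fun t => a *: U (x :: t) + U (y :: t))).
    by rewrite wedge_linear lin scalerDl opprD addrACA scalerBr scalerA.
  by move=> t; rewrite szs => -[szt]; rewrite linU.
- move=> x; have [_ altU1 _] := altU.
  apply: (@alternatingB _ _ _ _ (fun s => phi x *: U s)).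
    exact: alternatingZ.
  exact: (IH (fun t => U (x :: t)) (altU1 x)).
- move=> x s [szs] /=; have [_ _ U0] := altU.
  rewrite (@eq_wedge _ _ (fun=> 0)) => [|t szt].
    by rewrite wedge0 subr0 subrr.
  by apply: U0; rewrite szt szs.
Qed.

Lemma wedge_vanish phi U s : (forall x, x \in s -> phi x = 0) -> wedge phi U s = 0.
Proof.
elim: s U => //= x s IH U phi0; rewrite phi0 ?mem_head // scale0r sub0r.
by rewrite IH ?oppr0 // => y ys; apply: phi0; rewrite inE ys orbT.
Qed.
End Wedge.

(** * Integer combinations of symbols *)

Local Open Scope nat_scope.

Definition dim_g := 9.
(** Vectors of the basis e, h, f, w_0, ..., w_5 are numbered from 0 to 8. *)
Definition indices := iota 0 dim_g.

Arguments indices : simpl never.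

Definition sl2_bracket (i j : nat) : seq (Z * nat) :=
  match i, j with
  | 0, 1 => [:: ((-2)%Z, 0)] | 1, 0 => [:: (2%Z, 0)]
  | 0, 2 => [:: (1%Z, 1)] | 2, 0 => [:: ((-1)%Z, 1)]
  | 1, 2 => [:: ((-2)%Z, 2)] | 2, 1 => [:: (2%Z, 2)]
  | _, _ => [::]
  end.

(** The action of e, h, f (i = 0, 1, 2) on w_m = f^m v / m!, where v is a
    highest weight vector of weight 5. *)
Definition sl2_action (i m : nat) : seq (Z * nat) :=
  match i, m with
  | 0, m'.+1 => [:: (Z.sub 5 (Z.of_nat m'), m')]
  | 1, _ => [:: (Z.sub 5 (Z.mul 2 (Z.of_nat m)), m)]
  | 2, _ => if m < 5 then [:: (Z.of_nat m.+1, m.+1)] else [::]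
  | _, _ => [::]
  end.

Definition bracket (i j : nat) : seq (Z * nat) :=
  if i < 3 then
    if j < 3 then sl2_bracket i j
    else [seq (q.1, q.2 + 3) | q <- sl2_action i (j - 3)]
  else if j < 3 then [seq (Z.opp q.1, q.2 + 3) | q <- sl2_action j (i - 3)]
  else [::].

Definition weight1 (i : nat) : Z :=
  if i < 3 then Z.sub 2 (Z.mul 2 (Z.of_nat i))
  else Z.sub 5 (Z.mul 2 (Z.of_nat (i - 3))).

(** The symbol (s, a) stands for the functional taking a cochain W to the
    coordinate of index a of its value on the basis vectors listed in s. *)
Definition symbol : Type := seq nat * nat.
Definition combination : Type := seq (Z * symbol).

(** The eigenvalue of h on the cochains dual to the symbol. *)
Definition weight (x : symbol) : Z :=
  Z.sub (weight1 x.2) (foldr (fun i => Z.add (weight1 i)) 0%Z x.1).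

Definition valid_symbol (k : nat) (w : Z) (x : symbol) : bool :=
  [&& size x.1 == k, all (ltn^~ dim_g) x.1, x.2 < dim_g & Z.eqb (weight x) w].
Definition normal_symbol (k : nat) (w : Z) (x : symbol) : bool :=
  valid_symbol k w x && sorted ltn x.1.

Definition scale_comb (c : Z) (p : combination) : combination :=
  [seq (Z.mul c q.1, q.2) | q <- p].
Definition opp_comb (p : combination) : combination := [seq (Z.opp q.1, q.2) | q <- p].
Definition cons_comb (i : nat) (p : combination) : combination :=
  [seq (q.1, (i :: q.2.1, q.2.2)) | q <- p].

(** The pullbacks of a symbol by the operations that make up list_diff are
    combinations of symbols; [subst_comb], [act_comb] and [diff_comb] follow the
    definitions of subst_sum, of the action and of list_diff. *)
Fixpoint subst_comb (i : nat) (s : seq nat) (a : nat) : combination :=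
  if s is j :: s' then
    [seq (q.1, (q.2 :: s', a)) | q <- bracket i j]
    ++ cons_comb j (subst_comb i s' a)
  else [::].

Definition act_comb (i : nat) (s : seq nat) (a : nat) : combination :=
  flatten [seq [seq (q.1, (s, c)) | q <- bracket i c & q.2 == a] | c <- indices].

Arguments act_comb : simpl never.

Fixpoint diff_comb (s : seq nat) (a : nat) : combination :=
  if s is i :: s' then
    act_comb i s' a ++ opp_comb (subst_comb i s' a)
    ++ opp_comb (cons_comb i (diff_comb s' a))
  else [::].

(** Insertion into an increasing list, with the sign of the permutation made,
    or 0 if i already occurs. *)
Fixpoint insert_sign (i : nat) (s : seq nat) : Z * seq nat :=
  if s is j :: s' then
    match Nat.compare i j with
    | Lt => (1%Z, i :: s)
    | Eq => (0%Z, [::])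
    | Gt => let: (e, t) := insert_sign i s' in (Z.opp e, j :: t)
    end
  else (1%Z, [:: i]).

Fixpoint sort_sign (s : seq nat) : Z * seq nat :=
  if s is i :: s' then
    let: (e, t) := sort_sign s' in
    let: (e', t') := insert_sign i t in (Z.mul e e', t')
  else (1%Z, [::]).

Fixpoint cmp_seq (s t : seq nat) : comparison :=
  match s, t with
  | [::], [::] => Eq
  | [::], _ => Lt
  | _, [::] => Gt
  | i :: s', j :: t' =>
      match Nat.compare i j with Eq => cmp_seq s' t' | c => c end
  end.

Definition cmp_sym (x y : symbol) : comparison :=
  match cmp_seq x.1 y.1 with Eq => Nat.compare x.2 y.2 | c => c end.

Fixpoint add_comb (p : combination) : combination -> combination :=
  fix add_p (q : combination) : combination :=
    match p, q with
    | [::], _ => q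
    | _, [::] => p
    | (c, x) :: p', (d, y) :: q' =>
        match cmp_sym x y with
        | Lt => (c, x) :: add_comb p' q
        | Gt => (d, y) :: add_p q'
        | Eq => let e := Z.add c d in
                if Z.eqb e 0 then add_comb p' q' else (e, x) :: add_comb p' q'
        end
    end.

Definition sort_comb (p : combination) : combination :=
  foldr (fun q acc =>
    let: (e, t) := sort_sign q.2.1 in
    if Z.eqb e 0 then acc else add_comb [:: (Z.mul e q.1, (t, q.2.2))] acc)
    [::] p.

Definition symbol_diff (x : symbol) : combination := sort_comb (diff_comb x.1 x.2).

Definition linear_extension (p : combination) (f : symbol -> combination) : combination :=
  foldr (fun q => add_comb (scale_comb q.1 (f q.2))) [::] p.

Definition coef (x : symbol) (p : combination) : Z :=
  foldr (fun q c => if cmp_sym q.2 x is Eq then Z.add q.1 c else c) 0%Z p.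

(** The value of p on the cochain whose entries are the coefficients of q. *)
Definition pairing (p q : combination) : Z :=
  foldr (fun r c => Z.add (Z.mul r.1 (coef r.2 q)) c) 0%Z p.

Fixpoint subsets (k : nat) (l : seq nat) : seq (seq nat) :=
  if l is i :: l' then
    (if k is k'.+1 then [seq i :: s | s <- subsets k' l'] else [::])
    ++ subsets k l'
  else if k is 0 then [:: [::]] else [::].

Definition weight0_symbols (k : nat) : seq symbol :=
  [seq x <- [seq (s, a) | s <- subsets k indices, a <- indices] | Z.eqb (weight x) 0].

Local Open Scope ring_scope.

Section IntegerScalars.
Variable F : numFieldType.

Definition zF (z : Z) : F := (int_of_Z z)%:~R.

Arguments zF : simpl never.

Lemma zFD a b : zF (Z.add a b) = zF a + zF b.
Proof. by rewrite /zF (rmorphD int_of_Z a b) rmorphD. Qed.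

Lemma zFM a b : zF (Z.mul a b) = zF a * zF b.
Proof. by rewrite /zF (rmorphM int_of_Z a b) rmorphM. Qed.

Lemma zFN a : zF (Z.opp a) = - zF a.
Proof. by rewrite /zF (rmorphN int_of_Z a) rmorphN. Qed.

Lemma zFB a b : zF (Z.sub a b) = zF a - zF b.
Proof. by rewrite zFD zFN. Qed.

Lemma zFN1 : zF (-1)%Z = -1. Proof. exact: (zFN 1%Z). Qed.

Lemma zFnat n : zF (Z.of_nat n) = n%:R.
Proof.
have -> : n%:R = (n%:Z)%:~R :> F by [].
by rewrite /zF; case: n => //= n; rewrite SuccNat2Pos.id_succ.
Qed.

Lemma zF_eq0 z : (zF z == 0) = Z.eqb z 0.
Proof.
rewrite /zF intr_eq0; case: z => //= p; apply/negbTE.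
by case: (Pos.to_nat p) (Pos2Nat.is_pos p) => // /PeanoNat.Nat.lt_irrefl.
Qed.

End IntegerScalars.
Arguments zF : simpl never.

Section Combinations.
Variables (F : numFieldType).
Local Notation zF := (zF F).
Implicit Types (f : symbol -> F) (p : combination) (x y : symbol).

Definition comb_eval f p : F := \sum_(q <- p) zF q.1 * f q.2.

Lemma comb_eval_nil f : comb_eval f [::] = 0.
Proof. exact: big_nil. Qed.

Lemma comb_eval_cons f r p : comb_eval f (r :: p) = zF r.1 * f r.2 + comb_eval f p.
Proof. by rewrite /comb_eval big_cons. Qed.

Lemma comb_eval_cat f p (q : combination) :
  comb_eval f (p ++ q) = comb_eval f p + comb_eval f q.
Proof. by rewrite /comb_eval big_cat. Qed.

Lemma comb_eval_scale f c p : comb_eval f (scale_comb c p) = zF c * comb_eval f p.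
Proof.
rewrite /comb_eval big_map mulr_sumr; apply: eq_bigr => q _.
by rewrite zFM mulrA.
Qed.

Lemma comb_eval_opp f p : comb_eval f (opp_comb p) = - comb_eval f p.
Proof.
by rewrite /comb_eval big_map -sumrN; apply: eq_bigr => q _; rewrite zFN mulNr.
Qed.

Lemma comb_eval_cons_comb f i p :
  comb_eval f (cons_comb i p) = comb_eval (fun x => f (i :: x.1, x.2)) p.
Proof. by rewrite /comb_eval big_map. Qed.

Lemma eq_comb_eval f g p : {in unzip2 p, f =1 g} -> comb_eval f p = comb_eval g p.
Proof.
move=> eqfg; rewrite /comb_eval big_seq [RHS]big_seq; apply: eq_bigr => q qp.
by rewrite eqfg // map_f.
Qed.

Lemma cmp_seq_eq s t : cmp_seq s t = Eq -> s = t.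
Proof.
elim: s t => [|i s IH] [|j t] //=.
case E: (Nat.compare i j) => // /IH ->.
by move/PeanoNat.Nat.compare_eq: E => ->.
Qed.

Lemma cmp_sym_eq x y : cmp_sym x y = Eq -> x = y.
Proof.
case: x y => [s a] [t c]; rewrite /cmp_sym /=; case E: (cmp_seq s t) => //.
by move/PeanoNat.Nat.compare_eq => ->; rewrite (cmp_seq_eq E).
Qed.

Lemma comb_eval_add f p (q : combination) :
  comb_eval f (add_comb p q) = comb_eval f p + comb_eval f q.
Proof.
elim: p q => [|[c x] p IH] q.
  by case: q => [|q0 q]; rewrite /= comb_eval_nil add0r.
elim: q => [|[d y] q IHq]; first by rewrite comb_eval_nil addr0.
rewrite [add_comb _ _]/=; case E: (cmp_sym x y).
- move/cmp_sym_eq: E => <-; rewrite !comb_eval_cons /= addrACA -mulrDl -zFD.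
  case: ifP; rewrite ?comb_eval_cons IH // -(zF_eq0 F) => /eqP ->.
  by rewrite mul0r add0r.
- by rewrite comb_eval_cons IH [in RHS]comb_eval_cons addrA.
- by rewrite comb_eval_cons IHq [in RHS](comb_eval_cons f (d, y)) addrCA.
Qed.

Arguments add_comb : simpl never.

Lemma comb_eval_bind f p (g : symbol -> combination) :
  comb_eval f (linear_extension p g) = comb_eval (fun x => comb_eval f (g x)) p.
Proof.
elim: p => [|q p IH]; first by rewrite /= !comb_eval_nil.
by rewrite /= comb_eval_add comb_eval_scale IH comb_eval_cons.
Qed.

Lemma comb_eval_coef p (q : combination) :
  comb_eval (fun x => zF (coef x q)) p = zF (pairing p q).
Proof.
elim: p => [|r p IH]; first by rewrite comb_eval_nil.
by rewrite comb_eval_cons IH /= zFD zFM.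
Qed.

Lemma comb_eval_zero f p : all (fun q => Z.eqb q.1 0) p -> comb_eval f p = 0.
Proof.
rewrite /comb_eval => /allP p0; rewrite big_seq big1 // => q /p0.
by rewrite -(zF_eq0 F) => /eqP ->; rewrite mul0r.
Qed.

End Combinations.
Arguments add_comb : simpl never.

Section Sorting.
Local Open Scope nat_scope.

Lemma perm_insert_sign i s : let r := insert_sign i s in
  r.1 <> 0%Z -> perm_eq r.2 (i :: s).
Proof.
elim: s => //= j s IH; case E: (Nat.compare i j) => //=.
case: (insert_sign i s) IH => e t /= IH e0.
have {}IH : perm_eq t (i :: s) by apply: IH => e1; rewrite e1 in e0.
apply: perm_trans (_ : perm_eq _ (j :: i :: s)) _; first by rewrite perm_cons.
by apply/permP => a /=; rewrite addnCA.
Qed.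

Lemma sorted_insert_sign i s : let r := insert_sign i s in
  sorted ltn s -> r.1 <> 0%Z -> sorted ltn r.2.
Proof.
elim: s => //= j s IH; case E: (Nat.compare i j) => //=.
  by move=> -> _; rewrite andbT; apply/ltP/PeanoNat.Nat.compare_lt_iff.
have := @perm_insert_sign i s; case: (insert_sign i s) IH => e t /= IH per js e0.
have e1 : e <> 0%Z by move=> e1; rewrite e1 in e0.
rewrite path_sortedE; last exact: ltn_trans.
rewrite IH // ?(path_sorted js) // andbT (perm_all _ (per e1)) /=.
move: js; rewrite path_sortedE; last exact: ltn_trans.
by case/andP=> -> _; rewrite andbT; apply/ltP/PeanoNat.Nat.compare_gt_iff.
Qed.

Lemma sort_signP s : let r := sort_sign s in
  r.1 <> 0%Z -> perm_eq r.2 s /\ sorted ltn r.2.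
Proof.
elim: s => //= i s; case: (sort_sign s) => e t /= IH.
have := @perm_insert_sign i t; have := @sorted_insert_sign i t.
case: (insert_sign i t) => e' t' /= sorted_t' perm_t' ee'.
have [|perm_t sorted_t] := IH; first by move=> e0; rewrite e0 in ee'.
have e'0 : e' <> 0%Z by move=> e0; rewrite e0 Z.mul_0_r in ee'.
split; last exact: sorted_t'.
by apply: perm_trans (perm_t' e'0) _; rewrite perm_cons.
Qed.

Lemma subseq_idx s : sorted ltn s -> all (ltn^~ dim_g) s -> subseq s indices.
Proof.
move=> sorted_s /allP s_lt.
suff -> : s = [seq i <- indices | i \in s] by apply: filter_subseq.
apply: (irr_sorted_eq ltn_trans ltnn) => //.
  by apply: sorted_filter; [exact: ltn_trans|exact: iota_ltn_sorted].
move=> i; rewrite mem_filter mem_iota /=; case: (boolP (i \in s)) => //= /s_lt.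
by rewrite /= add0n => ->.
Qed.

Lemma mem_subsets s l : subseq s l -> s \in subsets (size s) l.
Proof.
elim: l s => [|i l IH] [|j s] //=; first by move=> _; apply/IH/sub0seq.
rewrite mem_cat; by case: eqP => [->|_] /IH sub_s; rewrite ?map_f ?sub_s ?orbT.
Qed.

End Sorting.

Lemma bracketP i j q : (i < dim_g)%N -> (j < dim_g)%N -> q \in bracket i j ->
  (q.2 < dim_g)%N /\ weight1 q.2 = Z.add (weight1 i) (weight1 j).
Proof.
have chk : all (fun i => all (fun j => all (fun q : Z * nat =>
    (q.2 < dim_g)%N && Z.eqb (weight1 q.2) (Z.add (weight1 i) (weight1 j)))
  (bracket i j)) indices) indices by vm_compute.
move=> lti ltj qij; have := chk.
by move=> /allP/(_ i)/[!mem_iota]/(_ lti)/allP/(_ j)/[!mem_iota]/(_ ltj)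
  /allP/(_ q qij)/andP[-> /Z.eqb_spec].
Qed.

Lemma weight_cons i s a :
  weight (i :: s, a) = Z.sub (weight (s, a)) (weight1 i).
Proof. rewrite /weight /=; lia. Qed.

Lemma weight_perm s t a : perm_eq s t -> weight (s, a) = weight (t, a).
Proof.
move=> st; rewrite /weight /=; congr Z.sub.
have E r : foldr (fun i => Z.add (weight1 i)) 0%Z r = (\sum_(i <- r) weight1 i)%R.
  by elim: r => [|i r IH]; rewrite ?big_nil // big_cons /= IH.
by rewrite !E; apply: perm_big.
Qed.

Lemma valid_cons k w i x :
  (i < dim_g)%N -> valid_symbol k (Z.add w (weight1 i)) x ->
  valid_symbol k.+1 w (i :: x.1, x.2).
Proof.
rewrite /valid_symbol weight_cons /= => -> /and4P[/eqP-> -> -> /Z.eqb_spec].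
by case: x => s a /= ->; rewrite eqxx /=; apply/Z.eqb_spec; lia.
Qed.

Lemma valid_subst_comb i s a q :
  (i < dim_g)%N -> valid_symbol (size s) (weight (s, a)) (s, a) ->
  q \in subst_comb i s a ->
  valid_symbol (size s) (Z.sub (weight (s, a)) (weight1 i)) q.2.
Proof.
move=> lti /and4P[_ + lta _]; rewrite /= in lta *.
elim: s q => //= j s IH q /andP[ltj lts].
rewrite mem_cat => /orP[/mapP[r rij ->]|/mapP[r rs ->]].
  have [ltr wr] := bracketP lti ltj rij.
  rewrite /valid_symbol /= ltr lts lta eqxx /=; apply/Z.eqb_spec.
  by rewrite !weight_cons wr; lia.
apply: valid_cons => //; rewrite weight_cons.
by have := IH r lts rs; congr valid_symbol; lia.
Qed.

Lemma valid_act_comb i s a q :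
  (i < dim_g)%N -> all (ltn^~ dim_g) s -> (a < dim_g)%N ->
  q \in act_comb i s a ->
  valid_symbol (size s) (Z.sub (weight (s, a)) (weight1 i)) q.2.
Proof.
move=> lti lts lta /flatten_mapP[c]; rewrite mem_iota /= => ltc.
case/mapP=> r; rewrite mem_filter => /andP[/eqP ra ric] ->.
have [_ wr] := bracketP lti ltc ric.
rewrite /valid_symbol /= lts ltc eqxx /=; apply/Z.eqb_spec.
by rewrite /weight /= -ra wr; lia.
Qed.

Lemma diff_comb_cons i s a : diff_comb (i :: s) a =
  act_comb i s a ++ opp_comb (subst_comb i s a)
  ++ opp_comb (cons_comb i (diff_comb s a)).
Proof. by []. Qed.

(** The differential preserves weights, because the bracket does. *)
Lemma valid_diff_comb k s a q :
  size s = k.+1 -> all (ltn^~ dim_g) s -> (a < dim_g)%N ->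
  q \in diff_comb s a -> valid_symbol k (weight (s, a)) q.2.
Proof.
move=> + + lta; elim: s k q => // i s IH k q [szs] lt_is.
have /andP[lti lts] : (i < dim_g)%N && all (ltn^~ dim_g) s := lt_is.
rewrite diff_comb_cons weight_cons -szs.
rewrite (mem_cat _ (act_comb i s a)) (mem_cat _ (opp_comb _)).
case/or3P=> [|/mapP[r rs ->]|/mapP[r /mapP[r' r's ->] ->]].
- by move=> qa; apply: valid_act_comb qa.
- apply: (valid_subst_comb _ _ rs) => //.
  by rewrite /valid_symbol /= eqxx lts lta Z.eqb_refl.
case: k szs => [|k] szs; first by rewrite (size0nil szs) in r's.
rewrite szs; apply: valid_cons => //.
by have := IH k r' szs lts r's; congr valid_symbol; lia.
Qed.

(** * Elimination in weight zero, and the certificate *)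

Local Open Scope nat_scope.

(** A combination obtained by row operations, together with the combination of
    symbols of one degree more that the differential pulls back to it, up to
    the excluded columns. *)
Definition tracked_row : Type := combination * combination.

(** Dividing by the content keeps the integers small. *)
Definition primitive (r : tracked_row) : tracked_row :=
  let g := foldr (fun q => Z.gcd q.1) 0%Z (r.1 ++ r.2) in
  let div p := [seq (Z.div q.1 g, q.2) | q <- p] in (div r.1, div r.2).

Definition eliminate (x : symbol) (r r0 : tracked_row) : tracked_row :=
  let c := coef x r.1 in
  if Z.eqb c 0 then r else
  let d := coef x r0.1 in
  let comb2 p p0 := add_comb (scale_comb d p) (scale_comb (Z.opp c) p0) in
  primitive (comb2 r.1 r0.1, comb2 r.2 r0.2).

Definition sym_mem (x : symbol) (l : seq symbol) : bool :=
  has (fun y => if cmp_sym x y is Eq then true else false) l.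

(** Reduce the differential of x modulo the rows found so far, ignoring the
    columns in [used]; if it does not vanish, its leading symbol becomes a pivot
    and is cleared from the other rows. *)
Definition add_row (used : seq symbol) (acc : seq (symbol * tracked_row)) (x : symbol) :=
  let r := foldl (fun r p => eliminate p.1 r p.2)
    ([seq q <- symbol_diff x | ~~ sym_mem q.2 used], [:: (1%Z, x)]) acc in
  if r.1 is (_, y) :: _ then
    (y, r) :: [seq (p.1, eliminate y p.2 r) | p <- acc]
  else acc.

(** A common multiple of the pivots, so that the divisions below are exact. *)
Definition scaling : Z := 4200%Z.

Definition gauss (used : seq symbol) (k : nat) : seq (symbol * tracked_row) :=
  foldl (add_row used) [::] (weight0_symbols k).

(** The homotopy from degree [k.+1] to degree [k], and the symbols of degree
    [k.+1] that it reads. Once every pivot is scaled to [scaling], the tracked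
    side of the row with pivot y is, up to this factor, a row of the inverse of
    the pivot block of the differential. The symbols read are excluded as pivots
    in the next degree: the homotopy never reads what it writes, so its square
    is zero. *)
Definition solve_step (used : seq symbol) (k : nat) :
    seq (symbol * combination) * seq symbol :=
  let rows := gauss used k.+1 in
  ([seq (p.1, scale_comb (Z.div scaling (coef p.1 p.2.1)) p.2.2) | p <- rows],
   undup (flatten [seq [seq q.2 | q <- p.2.2] | p <- rows])).

(** For each degree: the homotopy, and the symbols that it neither reads nor
    writes, whose number is the dimension of the cohomology. *)
Fixpoint solve (n k : nat) (used : seq symbol) :=
  if n is n'.+1 then
    let: (h, used') := solve_step used k in
    (h, [seq x <- weight0_symbols k | ~~ sym_mem x used & ~~ sym_mem x (unzip1 h)])
      :: solve n' k.+1 used'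
  else [::].

Definition solution := Eval vm_compute in solve dim_g.+1 0 [::].

(** The homotopy in the form dual to cochains: the entry at x of its value on W
    is W evaluated at [homotopy x], which has one argument more than x. *)
Definition homotopy (x : symbol) : combination :=
  if Z.eqb (weight x) 0 then
    if [seq p.2 | p <- (nth ([::], [::]) solution (size x.1)).1
         & if cmp_sym p.1 x is Eq then true else false] is q :: _ then q
    else [::]
  else [::].

(** N - d H - H d, for N the scaling factor and H the homotopy. *)
Definition defect (x : symbol) : combination :=
  add_comb [:: (scaling, x)]
    (scale_comb (-1)%Z (add_comb (linear_extension (symbol_diff x) homotopy)
                                 (linear_extension (homotopy x) symbol_diff))).

(** The defect is N times the projection to the cohomology along the homotopy.
    When one symbol x is left over, this projection has rank one, so it is
    determined by its row at x, the form phi, and by its column at x, which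
    lists the entries of the cocycle z. *)
Definition class_data (k : nat) : combination * combination :=
  if (nth ([::], [::]) solution k).2 is x :: _ then
    ([seq q <- [seq (coef x (defect y), y) | y <- weight0_symbols k] | ~~ Z.eqb q.1 0],
     defect x)
  else ([::], [::]).

Definition classes := Eval vm_compute in mkseq class_data dim_g.+1.
Definition cocycle_comb k := (nth ([::], [::]) classes k).1.
Definition functional_comb k := (nth ([::], [::]) classes k).2.

Definition cocycle_coef (k : nat) (x : symbol) : Z :=
  if Z.eqb (weight x) 0 then coef x (cocycle_comb k) else 0%Z.

(** N (N - d H - H d) = z phi, in weight zero. *)
Definition check_homotopy k :=
  all (fun x => all (fun q => normal_symbol k.+1 0 q.2) (homotopy x) &&
    all (fun q => Z.eqb q.1 0) (add_comb (scale_comb scaling (defect x))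
        (scale_comb (Z.opp (coef x (cocycle_comb k))) (functional_comb k))))
    (weight0_symbols k).
Definition check_cocycle k :=
  all (fun x => Z.eqb (pairing (symbol_diff x) (cocycle_comb k)) 0) (weight0_symbols k.+1).
Definition check_functional k :=
  all (fun q => normal_symbol k 0 q.2) (functional_comb k)
  && nilp (linear_extension (functional_comb k) symbol_diff).
Definition check_value k :=
  if k \in [:: 1; 3; 4; 5; 6; 8] then
    Z.eqb (pairing (functional_comb k) (cocycle_comb k)) (Z.mul scaling scaling)
  else nilp (functional_comb k).

Lemma certificate : all (fun k => [&& check_homotopy k, check_cocycle k,
  check_functional k & check_value k]) (iota 0 dim_g.+1).
Proof. by vm_compute. Qed.

Local Open Scope ring_scope.

(** * Cochains in coordinates *)

Section Coordinates.
Variables (F : numFieldType) (L : lieAlgType F).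
Variables (b : nat -> L) (coord : nat -> L -> F).
Hypothesis coord_linear : forall i a x y,
  coord i (a *: x + y) = a * coord i x + coord i y.
Hypothesis coord_basis : forall i j, (i < dim_g)%N -> (j < dim_g)%N ->
  coord i (b j) = (i == j)%:R.
Hypothesis coordK : forall x, \sum_(i <- indices) coord i x *: b i = x.
Hypothesis lie_basis : forall i j, (i < dim_g)%N -> (j < dim_g)%N ->
  lie (b i) (b j) = \sum_(q <- bracket i j) zF F q.1 *: b q.2.

Local Notation M := (adjoint L).
Local Notation zF := (zF F).

Implicit Types (W U : seq L -> M) (s t : seq nat) (k a i : nat).

Lemma coord0 i : coord i 0 = 0.
Proof.
by have := coord_linear i (-1) 0 0; rewrite scaler0 addr0 mulN1r addNr.
Qed.

Lemma coordD i x y : coord i (x + y) = coord i x + coord i y.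
Proof. by have := coord_linear i 1 x y; rewrite scale1r mul1r. Qed.

Lemma coordZ i c x : coord i (c *: x) = c * coord i x.
Proof. by have := coord_linear i c x 0; rewrite !addr0 coord0 addr0. Qed.

Lemma coordN i x : coord i (- x) = - coord i x.
Proof. by rewrite -scaleN1r coordZ mulN1r. Qed.

Lemma coord_sum i (I : Type) (r : seq I) (f : I -> L) :
  coord i (\sum_(j <- r) f j) = \sum_(j <- r) coord i (f j).
Proof. exact: (big_morph _ (coordD i) (coord0 i)). Qed.

Lemma coord_comb a (f : nat -> F) :
  (a < dim_g)%N -> coord a (\sum_(i <- indices) f i *: b i) = f a.
Proof.
move=> lta; rewrite coord_sum.
rewrite (bigD1_seq a) ?mem_iota ?iota_uniq //= coordZ coord_basis // eqxx mulr1.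
rewrite big_seq_cond big1 ?addr0 // => i /andP[]; rewrite mem_iota /= => lti neq_ia.
by rewrite coordZ coord_basis // eq_sym (negbTE neq_ia) mulr0.
Qed.

Lemma coord_inj x y : (forall a, (a < dim_g)%N -> coord a x = coord a y) -> x = y.
Proof.
move=> eqxy; rewrite -[x]coordK -[y]coordK big_seq [RHS]big_seq.
by apply: eq_bigr => a; rewrite mem_iota /= => lta; rewrite eqxy.
Qed.

Local Notation bs := (map b).

Definition entry W (x : symbol) : F := coord x.2 (W (bs x.1)).

Lemma head_sum k W s (I : Type) (r : seq I) (c : I -> F) (f : I -> L) :
  alternating k.+1 W -> size s = k ->
  W (\sum_(j <- r) c j *: f j :: bs s) = \sum_(j <- r) c j *: W (f j :: bs s).
Proof.
move=> altW szs; have szbs : size (bs s) = k by rewrite size_map.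
elim: r => [|j r IH]; first by rewrite !big_nil (alternating_head0 altW).
by rewrite !big_cons (alternating_headD altW) // (alternating_headZ altW) // IH.
Qed.

Lemma alternating_insert k W i s : alternating k.+1 W -> size s = k ->
  W (b i :: bs s) = zF (insert_sign i s).1 *: W (bs (insert_sign i s).2).
Proof.
elim: s k W => [|j s IH] [|k] W // altW => [_|[szs]].
  by rewrite scale1r.
have [_ altW1 W0] := altW; rewrite [insert_sign _ _]/=.
case E: (Nat.compare i j).
- move/PeanoNat.Nat.compare_eq: E => ->; rewrite scale0r.
  by apply: W0; rewrite size_map szs.
- by rewrite scale1r.
have := IH k (fun u : seq L => W (b j :: u)) (altW1 (b j)) szs.
case: (insert_sign i s) => e t /= IHt.
by rewrite (alternating_swap _ _ altW) ?size_map // IHt zFN scaleNr.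
Qed.

Lemma alternating_sort k W s : alternating k W -> size s = k ->
  W (bs s) = zF (sort_sign s).1 *: W (bs (sort_sign s).2).
Proof.
elim: s k W => [|i s IH] [|k] W // altW => [_|[szs]]; first by rewrite scale1r.
have [_ altW1 _] := altW.
rewrite /=; have := IH k (fun u : seq L => W (b i :: u)) (altW1 (b i)) szs.
have := @sort_signP s; case: (sort_sign s) => e t /= sortP ->.
have := @alternating_insert k W i t; case: (insert_sign i t) => e' t' /= ins.
have [e0|/eqP e0] := eqVneq e 0%Z; first by rewrite e0 !scale0r.
have [/perm_size szt _] := sortP e0.
by rewrite ins ?szt // scalerA -zFM.
Qed.

Lemma entry_sort k W x : alternating k W -> size x.1 = k ->
  entry W x = zF (sort_sign x.1).1 * entry W ((sort_sign x.1).2, x.2).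
Proof. by move=> altW szx; rewrite /entry (alternating_sort altW) // coordZ. Qed.

Lemma comb_eval_sort_comb k W p : alternating k W ->
  (forall q, q \in p -> size q.2.1 = k) ->
  comb_eval (entry W) (sort_comb p) = comb_eval (entry W) p.
Proof.
move=> altW; elim: p => // q p IH szp.
rewrite /= comb_eval_cons (entry_sort altW) ?szp ?mem_head //.
case: (sort_sign q.2.1) => e t /=.
have {}IH : comb_eval (entry W) (sort_comb p) = comb_eval (entry W) p.
  by apply: IH => r rp; apply: szp; rewrite inE rp orbT.
case: ifP => [|_].
  by rewrite -(zF_eq0 F) => /eqP ->; rewrite mul0r mulr0 add0r.
rewrite comb_eval_add IH comb_eval_cons /= zFM comb_eval_nil addr0.
by rewrite mulrA [zF e * _]mulrC.
Qed.

Lemma sum_coord_bracket a (r : seq (Z * nat)) (f : F) :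
  (a < dim_g)%N -> {in r, forall q, (q.2 < dim_g)%N} ->
  \sum_(q <- r | q.2 == a) zF q.1 * f = f * coord a (\sum_(q <- r) zF q.1 *: b q.2).
Proof.
move=> lta ltr; rewrite coord_sum big_mkcond mulr_sumr big_seq [RHS]big_seq.
apply: eq_bigr => q qr; rewrite coordZ coord_basis ?ltr // eq_sym.
by case: eqP => _; rewrite ?mulr1 ?mulr0 // mulrC.
Qed.

Lemma lieZr (c : F) (x y : L) : lie x (c *: y) = c *: lie x y.
Proof. exact: (@lie_actZr _ _ M x c y). Qed.

Lemma lie_sumr (x : L) (I : Type) (r : seq I) (f : I -> L) :
  lie x (\sum_(j <- r) f j) = \sum_(j <- r) lie x (f j).
Proof.
apply: (big_morph (lie x)) => [y z|]; first exact: lieDr.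
exact: (@lie_act0r _ _ M).
Qed.

Lemma comb_eval_act_comb W i s a : (i < dim_g)%N -> (a < dim_g)%N ->
  comb_eval (entry W) (act_comb i s a) = coord a (lie (b i) (W (bs s))).
Proof.
move=> lti lta; rewrite -[in RHS](coordK (W (bs s))) lie_sumr coord_sum.
rewrite /comb_eval /act_comb big_flatten big_map big_seq [RHS]big_seq.
apply: eq_bigr => c; rewrite mem_iota => /= ltc.
rewrite big_map big_filter /= (sum_coord_bracket _ lta) => [|q qic].
  by rewrite lieZr coordZ lie_basis.
by have [] := bracketP lti ltc qic.
Qed.

Lemma comb_eval_subst_comb k W i s a : alternating k W -> size s = k ->
  (i < dim_g)%N -> all (ltn^~ dim_g) s ->
  comb_eval (entry W) (subst_comb i s a) = coord a (subst_sum (b i) W (bs s)).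
Proof.
move=> + + lti; elim: s k W => [|j s IH] [|k] W //= altW.
  by rewrite comb_eval_nil coord0.
move=> [szs] /andP[ltj lts]; have [_ altW1 _] := altW.
rewrite comb_eval_cat coordD comb_eval_cons_comb lie_basis // (head_sum _ _ _ altW) //.
congr (_ + _); last by rewrite -(IH k).
by rewrite coord_sum /comb_eval big_map; apply: eq_bigr => q _; rewrite coordZ.
Qed.

Lemma comb_eval_diff_comb k W s a : alternating k W -> size s = k.+1 ->
  all (ltn^~ dim_g) s -> (a < dim_g)%N ->
  comb_eval (entry W) (diff_comb s a) = entry (list_diff W) (s, a).
Proof.
move=> + + + lta; elim: s k W => // i s IH k W altW [szs] lt_is.
have /andP[lti lts] : (i < dim_g)%N && all (ltn^~ dim_g) s := lt_is.
rewrite diff_comb_cons (comb_eval_cat _ (act_comb i s a)).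
rewrite (comb_eval_cat _ (opp_comb _)) !comb_eval_opp comb_eval_act_comb //.
rewrite (comb_eval_subst_comb _ altW) //.
rewrite /entry /= !coordD !coordN addrA; congr (_ - _); rewrite comb_eval_cons_comb.
case: k altW szs => [_ szs|k altW szs].
  by rewrite (size0nil szs) /= coord0 comb_eval_nil.
have [_ altW1 _] := altW.
exact: (IH k (fun u : seq L => W (b i :: u)) (altW1 (b i)) szs lts).
Qed.

(** The cochain with prescribed values on increasing lists of basis vectors,
    built from wedge products of coordinate forms by running through the basis:
    a list either starts with the first index i of l, or does not contain it. *)
Fixpoint extension (l : seq nat) (k : nat) (C : seq nat -> M) : seq L -> M :=
  if k is k'.+1 then
    if l is i :: l' then
      fun u : seq L =>
        wedge (coord i) (extension l' k' (fun t => C (i :: t))) u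
        + extension l' k C u
    else fun=> 0
  else fun=> C [::].

Lemma alternating_extension l k C : alternating k (extension l k C).
Proof.
elim: l k C => [|i l IH] [|k] C //; first exact: alternating0.
by apply: alternatingD => //; apply: alternating_wedge.
Qed.

Lemma extension_vanish i l k C (s : seq L) : i \notin l -> (i < dim_g)%N ->
  all (ltn^~ dim_g) l -> size s = k -> extension l k.+1 C (b i :: s) = 0.
Proof.
move=> + lti; elim: l k C s => // j l IH k C s.
rewrite inE negb_or => /andP[neq_ij il] /andP[ltj ltl] szs.
rewrite [LHS]/= coord_basis // eq_sym (negbTE neq_ij) scale0r sub0r IH // addr0.
rewrite (@eq_wedge _ _ _ _ _ (fun=> 0)) ?wedge0 ?oppr0 // => t szt.
by rewrite -szs -szt IH.
Qed.

Lemma extensionE l t C : uniq l -> all (ltn^~ dim_g) l -> subseq t l ->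
  extension l (size t) C (bs t) = C t.
Proof.
elim: l t C => [|i l IH] [|j t] C //= /andP[il uniq_l] /andP[lti ltl].
case: eqP => [-> sub_t|_ sub_t].
  rewrite coord_basis // eqxx scale1r (IH t) // extension_vanish ?size_map // addr0.
  rewrite wedge_vanish ?subr0 // => x /mapP[m mt ->].
  have ml := mem_subseq sub_t mt; have ltm : (m < dim_g)%N := allP ltl m ml.
  rewrite coord_basis //; case: (i =P m) => // im.
  by rewrite im ml in il.
have ltj : (j < dim_g)%N.
  by apply: (allP ltl); apply: (mem_subseq sub_t); rewrite mem_head.
have := IH (j :: t) C uniq_l ltl sub_t; rewrite [bs _]/= => ->.
have := @wedge_vanish _ _ M (coord i)
  (extension l (size t) (fun t => C (i :: t))) (bs (j :: t)).
rewrite /= => ->; first by rewrite add0r.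
move=> x /(mapP (s := j :: t))[m mt ->]; have ml := mem_subseq sub_t mt.
have ltm : (m < dim_g)%N := allP ltl m ml.
rewrite coord_basis //; case: (i =P m) => // im.
by rewrite im ml in il.
Qed.

(** The cochain with prescribed entries at the normal symbols. *)
Definition of_coords (k : nat) (f : symbol -> F) : seq L -> M :=
  extension indices k (fun t => \sum_(a <- indices) f (t, a) *: b a).

Lemma alternating_of_coords k f : alternating k (of_coords k f).
Proof. exact: alternating_extension. Qed.

Lemma entry_of_coords k f t a : subseq t indices -> size t = k -> (a < dim_g)%N ->
  entry (of_coords k f) (t, a) = f (t, a).
Proof.
move=> sub_t <- lta.
have := @extensionE indices t (fun t => \sum_(a <- indices) f (t, a) *: b a).
rewrite /entry /of_coords => -> //; first exact: (coord_comb (fun a => f (t, a))).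
Qed.

(** An alternating map is determined by its values on increasing lists of basis
    vectors: sorting reduces arbitrary lists of basis vectors to these, and
    linearity reduces arbitrary vectors to basis vectors. *)
Lemma alternating_eq0 k W : alternating k W ->
  (forall t a, subseq t indices -> size t = k -> (a < dim_g)%N -> entry W (t, a) = 0) ->
  forall s : seq L, size s = k -> W s = 0.
Proof.
move=> altW W0.
have {}W0 t : size t = k -> all (ltn^~ dim_g) t -> W (bs t) = 0.
  move=> szt ltt; apply: coord_inj => a lta; rewrite coord0.
  have := @entry_sort k W (t, a) altW szt; rewrite {1}/entry /= => ->.
  have := @sort_signP t; case: (sort_sign t) => e t' /= sortP.
  have [->|/eqP e0] := eqVneq e 0%Z; first by rewrite mul0r.
  have [perm_t sorted_t] := sortP e0.
  rewrite W0 ?mulr0 ?(perm_size perm_t) //.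
  by apply: subseq_idx => //; rewrite (perm_all _ perm_t).
elim: k W altW W0 => [|k IH] W altW W0 [|x s] // => [_|[szs]].
  exact: (W0 [::]).
have [linW altW1 _] := altW.
have W_basis i : (i < dim_g)%N -> W (b i :: s) = 0.
  move=> lti; apply: (IH (fun u => W (b i :: u)) (altW1 (b i))) => // t szt ltt.
  by apply: (W0 (i :: t)); rewrite /= ?szt ?lti.
rewrite -[x]coordK big_seq; elim/big_rec: _ => [|i y].
  exact: alternating_head0 altW _ _.
rewrite mem_iota /= => lti Wy0.
rewrite (alternating_headD altW) // (alternating_headZ altW) //.
by rewrite W_basis // scaler0 add0r.
Qed.

Lemma all_add_comb (P : pred symbol) (p q : combination) :
  all (fun r => P r.2) p -> all (fun r => P r.2) q ->
  all (fun r => P r.2) (add_comb p q).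
Proof.
elim: p q => [|[c x] p IH]; first by case.
move=> q /andP[Px Pp]; elim: q => [|[d y] q IHq]; first by rewrite /= Px.
move=> Pdq; have /andP[Py Pq] := Pdq; rewrite /add_comb -/add_comb.
case: (cmp_sym x y) => /=.
- by case: ifP => _ /=; rewrite ?Px IH.
- by rewrite Px IH.
- by have := IHq Pq; rewrite {1}/add_comb -/add_comb => ->; rewrite andbT.
Qed.

Lemma normal_sort_comb k w p : all (fun q => valid_symbol k w q.2) p ->
  all (fun q => normal_symbol k w q.2) (sort_comb p).
Proof.
elim: p => // q p IH /andP[vq /IH {}IH] /=.
have := @sort_signP q.2.1; case: (sort_sign q.2.1) => e t /= sortP.
case: ifP => [//|/negbT/Z.eqb_spec/sortP[perm_t sorted_t]].
apply: all_add_comb => //=; rewrite andbT /normal_symbol sorted_t andbT.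
move: vq; rewrite /valid_symbol; case: (q.2) perm_t => s a /= perm_t.
by rewrite (perm_size perm_t) (perm_all _ perm_t) (weight_perm a perm_t).
Qed.

Lemma diff_nil w x : valid_symbol 0 w x -> symbol_diff x = [::].
Proof. by case: x => -[]. Qed.

Lemma normal_diff k w x : valid_symbol k w x ->
  all (fun q => normal_symbol k.-1 w q.2) (symbol_diff x).
Proof.
case: x => s a; case: k => [/diff_nil -> //|k] /and4P[/eqP szs lts lta /Z.eqb_spec <-].
by apply: normal_sort_comb; apply/allP => q; apply: valid_diff_comb.
Qed.

Lemma valid_idx t a : subseq t indices -> (a < dim_g)%N ->
  valid_symbol (size t) (weight (t, a)) (t, a).
Proof.
move=> sub_t lta; rewrite /valid_symbol eqxx lta Z.eqb_refl /= andbT.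
by apply/allP => i /(mem_subseq sub_t); rewrite mem_iota.
Qed.

Lemma normal_idx k w x : normal_symbol k w x -> subseq x.1 indices.
Proof. by case/andP=> /and4P[_ ltx _ _] /subseq_idx; apply. Qed.

Lemma mem_weight0 k x : normal_symbol k 0%Z x -> x \in weight0_symbols k.
Proof.
case: x => s a nx; have sub_s := normal_idx nx.
have /andP[/and4P[/eqP szs _ lta w0] _] := nx.
rewrite mem_filter w0 andTb; apply/allpairsPdep; exists s, a; split=> //.
  by rewrite -szs mem_subsets.
by rewrite mem_iota.
Qed.

Lemma eq_comb_eval_normal k w (f g : symbol -> F) p :
  all (fun q => normal_symbol k w q.2) p ->
  (forall x, normal_symbol k w x -> f x = g x) -> comb_eval f p = comb_eval g p.
Proof.
move=> /allP vp eqfg; apply: eq_comb_eval => x /mapP[q qp ->].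
by apply: eqfg; apply: vp.
Qed.

Lemma entry_diff k w W x : alternating k.-1 W -> valid_symbol k w x ->
  entry (list_diff W) x = comb_eval (entry W) (symbol_diff x).
Proof.
case: x => s a; case: k => [_ vx|k].
  rewrite (diff_nil vx) comb_eval_nil; case: s vx => // _.
  by rewrite /entry /= coord0.
move=> altW /and4P[/eqP szs lts lta /Z.eqb_spec wx].
rewrite (comb_eval_sort_comb altW) ?(comb_eval_diff_comb altW) // => q.
by move=> /(valid_diff_comb szs lts lta)/and4P[/eqP].
Qed.

Lemma entry_of_coords_normal k w f x : normal_symbol k w x -> entry (of_coords k f) x = f x.
Proof.
case: x => s a nx; have /andP[/and4P[/eqP szs _ lta _] _] := nx.
by apply: entry_of_coords (normal_idx nx) _ _.
Qed.

Lemma entryB W U x : entry (fun u : seq L => W u - U u) x = entry W x - entry U x.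
Proof. by rewrite /entry coordD coordN. Qed.

Lemma comb_eval_zero_fun p : comb_eval (fun=> 0 : F) p = 0.
Proof. by rewrite /comb_eval big1 // => q _; rewrite mulr0. Qed.

Lemma comb_eval_mull c (f : symbol -> F) p :
  comb_eval (fun x => c * f x) p = c * comb_eval f p.
Proof. by rewrite /comb_eval mulr_sumr; apply: eq_bigr => q _; rewrite mulrCA. Qed.

(** * Contraction in nonzero weight *)

Definition rescale (phi : Z -> F) k W := of_coords k (fun x => phi (weight x) * entry W x).

Lemma entry_rescale phi k w W x : alternating k W -> valid_symbol k w x ->
  entry (rescale phi k W) x = phi w * entry W x.
Proof.
case: x => s a altW /and4P[/eqP szs lts lta /Z.eqb_spec <-].
rewrite (entry_sort (x := (s, a)) (alternating_of_coords _ _)) //.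
rewrite (entry_sort (x := (s, a)) altW) //=.
have := @sort_signP s; case: (sort_sign s) => e t /= sortP.
have [->|/eqP e0] := eqVneq e 0%Z; first by rewrite !mul0r mulr0.
have [perm_t sorted_t] := sortP e0.
rewrite entry_of_coords //; last by rewrite (perm_size perm_t).
  by rewrite (weight_perm a perm_t) mulrCA.
by apply: subseq_idx; rewrite // (perm_all _ perm_t).
Qed.

Lemma lie_cartan j : (j < dim_g)%N -> lie (b 1) (b j) = zF (weight1 j) *: b j.
Proof.
move=> ltj; rewrite lie_basis //.
have chk : all (fun j => bracket 1 j == if Z.eqb (weight1 j) 0 then [::]
    else [:: (weight1 j, j)]) indices by vm_compute.
have /eqP -> := allP chk j ltac:(by rewrite mem_iota).
case: ifP => [|_]; last by rewrite big_seq1.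
by rewrite -(zF_eq0 F) => /eqP ->; rewrite scale0r big_nil.
Qed.

Lemma coord_lie_cartan a y : (a < dim_g)%N ->
  coord a (lie (b 1) y) = zF (weight1 a) * coord a y.
Proof.
move=> lta; rewrite -{1}(coordK y) lie_sumr.
rewrite -(coord_comb (fun i => zF (weight1 i) * coord i y) lta); congr (coord a _).
rewrite big_seq [RHS]big_seq; apply: eq_bigr => i; rewrite mem_iota => lti.
by rewrite lieZr lie_cartan // scalerA mulrC.
Qed.

Lemma subst_sum_cartan k W s : alternating k W -> size s = k ->
  all (ltn^~ dim_g) s ->
  subst_sum (b 1) W (bs s)
    = zF (foldr (fun i => Z.add (weight1 i)) 0%Z s) *: W (bs s).
Proof.
elim: s k W => [|i s IH] [|k] W //= altW; first by rewrite scale0r.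
move=> [szs] /andP[lti lts]; have [_ altW1 _] := altW.
rewrite lie_cartan // (alternating_headZ altW) ?size_map //.
have := IH k (fun u : seq L => W (b i :: u)) (altW1 (b i)) szs lts => /= ->.
by rewrite zFD scalerDl.
Qed.

(** Cartan's formula for h, whose Lie derivative multiplies by the weight. *)
Lemma entry_cartan k w W x : alternating k W -> valid_symbol k w x ->
  entry (list_diff (fun u => W (b 1 :: u))) x
    = zF w * entry W x - entry (list_diff W) (1%N :: x.1, x.2).
Proof.
case: x => s a altW /and4P[/eqP szs lts lta /Z.eqb_spec <-].
rewrite /entry /= !coordD !coordN coord_lie_cartan // (subst_sum_cartan altW) //.
by rewrite coordZ zFB mulrBl subKr.
Qed.

(** U is the contraction of W by h divided by the weight, on the components of
    nonzero weight. For a cocycle W, Cartan's formula says that d (i_h W) is W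
    multiplied by the weight. *)
Lemma weight0_reduction k W : alternating k W ->
  (forall s : seq L, size s = k.+1 -> list_diff W s = 0) ->
  exists2 U, alternating k.-1 U &
  [/\ forall w x, w <> 0%Z -> valid_symbol k w x -> entry (list_diff U) x = entry W x
    & forall x, valid_symbol k 0%Z x -> entry (list_diff U) x = 0].
Proof.
move=> altW dW; pose iW := fun u : seq L => W (b 1 :: u).
have cartan w x : valid_symbol k w x -> entry (list_diff iW) x = zF w * entry W x.
  move=> vx; rewrite (entry_cartan altW vx) [X in _ - X](_ : _ = 0) ?subr0 //.
  have /and4P[/eqP szx _ _ _] := vx.
  by rewrite /entry dW ?coord0 //= size_map szx.
have zF0 w : w <> 0%Z -> zF w != 0 by move=> w0; rewrite zF_eq0; apply/Z.eqb_spec.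
have altiW : alternating k.-1 iW.
  by case: (k) altW => // k' [_ altW1 _]; apply: altW1.
(* The inverse of the weight where it has one, and 0 in weight zero. *)
pose phi w := if Z.eqb w 0 then 0 else (zF w)^-1.
have dU w x : valid_symbol k w x ->
    entry (list_diff (rescale phi k.-1 iW)) x = phi w * (zF w * entry W x).
  move=> vx; rewrite (entry_diff (alternating_of_coords _ _) vx) -cartan //.
  rewrite (entry_diff altiW vx) -comb_eval_mull.
  apply: (eq_comb_eval_normal (normal_diff vx)) => y /andP[vy _].
  exact: entry_rescale.
exists (rescale phi k.-1 iW); first exact: alternating_of_coords.
split=> [w x w0 vx|x vx]; rewrite (dU _ _ vx) /phi; last by rewrite mul0r.
have -> : Z.eqb w 0 = false by apply/Z.eqb_spec.
by rewrite mulKf ?zF0.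
Qed.

(** * Contraction in weight zero *)

Lemma homotopy_weight x : weight x <> 0%Z -> homotopy x = [::].
Proof. by rewrite /homotopy => /Z.eqb_spec/negbTE ->. Qed.

Lemma certificate_at k : (k <= dim_g)%N ->
  [/\ check_homotopy k, check_cocycle k, check_functional k & check_value k].
Proof.
move=> lek; apply/and4P; have /allP := certificate; apply.
by rewrite mem_iota.
Qed.

Lemma size_subseq_idx t : subseq t indices -> (size t <= dim_g)%N.
Proof. by move/size_subseq; rewrite size_iota. Qed.

(** The linear form phi of the introduction. *)
Definition functional k W : F := comb_eval (entry W) (functional_comb k).
(** The cocycle z of the introduction. *)
Definition class_cochain k : seq L -> M :=
  of_coords k (fun x => zF (cocycle_coef k x)).

(** The identity of the certificate, applied to a cochain W of weight zero: the
    term H d W vanishes, because d W does in weight zero. At symbols of nonzero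
    weight both sides vanish. *)
Lemma homotopy_identity k W : alternating k W ->
  (forall w x, w <> 0%Z -> valid_symbol k w x -> entry W x = 0) ->
  (forall x, valid_symbol k.+1 0%Z x -> entry (list_diff W) x = 0) ->
  let U := of_coords k.-1 (fun x => comb_eval (entry W) (homotopy x)) in
  forall s : seq L, size s = k ->
  (zF scaling) ^+ 2 *: W s
    = zF scaling *: list_diff U s + functional k W *: class_cochain k s.
Proof.
move=> altW W0 dW U s szs; apply/eqP; rewrite -subr_eq0; apply/eqP.
have altU : alternating k.-1 U by apply: alternating_of_coords.
have altdU := alternating_list_diff_pred altU.
pose D (u : seq L) := zF scaling ^+ 2 *: W u
  - (zF scaling *: list_diff U u + functional k W *: class_cochain k u).
apply: (@alternating_eq0 k D) => // [|t a sub_t szt lta].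
  apply: alternatingB; first exact: alternatingZ.
  apply: alternatingD; apply: alternatingZ => //; exact: alternating_of_coords.
set x := (t, a); have vx : valid_symbol k (weight x) x by rewrite -szt valid_idx.
have nx : normal_symbol k (weight x) x.
  by rewrite /normal_symbol vx (subseq_sorted ltn_trans sub_t) // iota_ltn_sorted.
have -> : entry D x = zF scaling ^+ 2 * entry W x
    - (zF scaling * entry (list_diff U) x
       + functional k W * zF (cocycle_coef k x)).
  rewrite -(entry_of_coords_normal (fun x => zF (cocycle_coef k x)) nx).
  by rewrite /entry coordD coordN coordD !coordZ.
have valdU : entry (list_diff U) x
    = comb_eval (fun y => comb_eval (entry W) (homotopy y)) (symbol_diff x).
  rewrite (entry_diff altU vx); apply: (eq_comb_eval_normal (normal_diff vx)) => y ny.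
  exact: entry_of_coords_normal ny.
rewrite {}valdU /cocycle_coef; case: ifP => [/Z.eqb_spec w0|/Z.eqb_spec w0]; last first.
  move: (zF scaling) => N; rewrite (W0 _ _ w0 vx) mulr0 sub0r mulr0 addr0.
  rewrite [comb_eval _ _](_ : _ = 0) ?mulr0 ?oppr0 //.
  rewrite -[RHS](comb_eval_zero_fun (symbol_diff x)).
  apply: (eq_comb_eval_normal (normal_diff vx)) => y /andP[/and4P[_ _ _ /Z.eqb_spec wy] _].
  by rewrite homotopy_weight ?comb_eval_nil // wy.
rewrite w0 in vx nx.
have lek : (k <= dim_g)%N by rewrite -szt size_subseq_idx.
have [/allP/(_ x (mem_weight0 nx))/andP[nh chk] _ _ _] := certificate_at lek.
(* The entries of H d W are combinations of values of d W in weight zero. *)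
have dh0 : comb_eval (entry W) (linear_extension (homotopy x) symbol_diff) = 0.
  rewrite comb_eval_bind -[RHS](comb_eval_zero_fun (homotopy x)).
  apply: (eq_comb_eval_normal nh) => y /andP[vy _].
  by rewrite -(@entry_diff k.+1 _ _ _ altW vy) dW.
have := comb_eval_zero (entry W) chk.
rewrite comb_eval_add !comb_eval_scale /defect comb_eval_add comb_eval_scale.
rewrite comb_eval_add dh0 addr0 comb_eval_cons; move: (zF scaling) => N.
rewrite comb_eval_bind comb_eval_nil addr0 zFN1 mulN1r zFN mulNr => <-.
rewrite -[comb_eval _ (functional_comb k)]/(functional k W).
by rewrite /= mulrBr mulrA -expr2 opprD addrA [functional k W * _]mulrC.
Qed.

Lemma class_cochainP k (s : seq L) : size s = k.+1 -> list_diff (class_cochain k) s = 0.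
Proof.
have altZ : alternating k (class_cochain k) by apply: alternating_of_coords.
apply: alternating_eq0; first exact: alternating_list_diff.
move=> t a sub_t szt lta; set x := (t, a).
have vx : valid_symbol k.+1 (weight x) x by rewrite -szt valid_idx.
rewrite (@entry_diff k.+1 _ _ _ altZ vx).
rewrite (eq_comb_eval_normal (normal_diff vx)
  (g := fun y => zF (cocycle_coef k y))); last first.
  by move=> y ny; apply: entry_of_coords_normal ny.
have [w0|w0] := Z.eqb_spec (weight x) 0; last first.
  rewrite -[RHS](comb_eval_zero_fun (symbol_diff x)).
  apply: (eq_comb_eval_normal (normal_diff vx)) => y /andP[/and4P[_ _ _ /Z.eqb_spec wy] _].
  by rewrite /cocycle_coef wy; have /Z.eqb_spec/negbTE -> := w0.
rewrite w0 in vx.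
have nx : normal_symbol k.+1 0%Z x.
  by rewrite /normal_symbol vx (subseq_sorted ltn_trans sub_t) // iota_ltn_sorted.
have ltk : (k <= dim_g)%N by rewrite ltnW // -szt size_subseq_idx.
have [_ /allP/(_ x (mem_weight0 nx)) /Z.eqb_spec dot0 _ _] := certificate_at ltk.
rewrite (eq_comb_eval_normal (normal_diff vx)
  (g := fun y => zF (coef y (cocycle_comb k)))).
  by rewrite comb_eval_coef dot0.
by move=> y /andP[/and4P[_ _ _ wy] _]; rewrite /cocycle_coef wy.
Qed.

Lemma functional_comb_out k : (dim_g < k)%N -> functional_comb k = [::].
Proof. by move=> ltk; rewrite /functional_comb nth_default. Qed.

Lemma normal_functional k : all (fun q => normal_symbol k 0%Z q.2) (functional_comb k).
Proof.
have [lek|ltk] := leqP k dim_g; last by rewrite functional_comb_out.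
by have [_ _ /andP[]] := certificate_at lek.
Qed.

Lemma eq_functional k W U :
  (forall s : seq L, size s = k -> W s = U s) -> functional k W = functional k U.
Proof.
move=> eqWU; apply: (eq_comb_eval_normal (normal_functional k)) => x.
by case/andP=> /and4P[/eqP szx _ _ _] _; rewrite /entry eqWU ?size_map.
Qed.

Lemma functional_list_diff k U :
  alternating k.-1 U -> functional k (list_diff U) = 0.
Proof.
move=> altU; rewrite /functional.
have [lek|ltk] := leqP k dim_g; last by rewrite functional_comb_out // comb_eval_nil.
have [_ _ /andP[_ /nilP bind0] _] := certificate_at lek.
rewrite -(comb_eval_nil (entry U)) -bind0 comb_eval_bind.
apply: (eq_comb_eval_normal (normal_functional k)) => x /andP[vx _].
by rewrite (entry_diff altU vx).
Qed.

Definition class_degrees := [:: 1; 3; 4; 5; 6; 8]%N.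

Lemma functional_class k : k \in class_degrees ->
  functional k (class_cochain k) = zF scaling ^+ 2.
Proof.
move=> kdeg; have lek : (k <= dim_g)%N by move: k kdeg; apply/allP.
have [_ _ _] := certificate_at lek.
rewrite /check_value kdeg => /Z.eqb_spec val_k.
rewrite /functional (eq_comb_eval_normal (normal_functional k)
  (g := fun x => zF (coef x (cocycle_comb k)))).
  by rewrite comb_eval_coef val_k zFM.
move=> x nx; rewrite (entry_of_coords_normal _ nx) /cocycle_coef.
by have /andP[/and4P[_ _ _ ->]] := nx.
Qed.

Lemma functional_other k W : k \notin class_degrees -> functional k W = 0.
Proof.
move=> kdeg; rewrite /functional.
have [lek|ltk] := leqP k dim_g; last by rewrite functional_comb_out // comb_eval_nil.
have [_ _ _] := certificate_at lek; rewrite /check_value (negbTE kdeg).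
by move/nilP ->; rewrite comb_eval_nil.
Qed.

(** Split off the components of nonzero weight, which are a coboundary, and
    apply the homotopy to what is left. *)
Lemma cocycle_decomposition k W : alternating k W ->
  (forall s : seq L, size s = k.+1 -> list_diff W s = 0) -> functional k W = 0 ->
  exists2 U, alternating k.-1 U & forall s : seq L, size s = k -> W s = list_diff U s.
Proof.
move=> altW dW fW.
have [U1 altU1 [U1_other U1_0]] := weight0_reduction altW dW.
pose W0 (u : seq L) := W u - list_diff U1 u.
have altW0 : alternating k W0.
  by apply: alternatingB => //; apply: alternating_list_diff_pred.
have W0_other w x : w <> 0%Z -> valid_symbol k w x -> entry W0 x = 0.
  by move=> w0 vx; rewrite entryB (U1_other w) // subrr.
have dW0 x : valid_symbol k.+1 0%Z x -> entry (list_diff W0) x = 0.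
  move=> vx; rewrite (@entry_diff k.+1 _ _ _ altW0 vx).
  rewrite (eq_comb_eval_normal (normal_diff vx) (g := entry W)).
    rewrite -(@entry_diff k.+1 _ _ _ altW vx) /entry dW ?coord0 // size_map.
    by have /and4P[/eqP] := vx.
  by move=> y /andP[vy _]; rewrite entryB U1_0 // subr0.
(* phi has weight zero, where W0 and W agree. *)
have fW0 : functional k W0 = 0.
  rewrite -fW; apply: (eq_comb_eval_normal (normal_functional k)) => y /andP[vy _].
  by rewrite entryB U1_0 // subr0.
have := homotopy_identity altW0 W0_other dW0; rewrite fW0.
set U2 := of_coords _ _ => dU2.
have : zF scaling != 0 by rewrite zF_eq0.
move: (zF scaling) dU2 => N dU2 N0.
exists (fun s : seq L => N^-1 *: U2 s + U1 s).
  by apply: alternating_linear => //; apply: alternating_of_coords.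
move=> s szs; rewrite list_diff_linear.
have := dU2 s szs; rewrite scale0r addr0 expr2 -scalerA.
by move/(scalerI N0) => <-; rewrite scalerA mulVf // scale1r subrK.
Qed.

End Coordinates.

(** * Cohomology spaces *)

Section QuotientLmodule.
Import Quotient.
Local Open Scope quotient_scope.
Variables (F : fieldType) (V : lmodType F) (S : submodClosed V).

Lemma quotlmod_eq (u v : V) :
  (\pi_(quotlmod S) u == \pi_(quotlmod S) v) = (u - v \in S).
Proof. by rewrite -(idealrBE (submod_pred S)). Qed.

Lemma repr_quotlmod (v : V) : repr (\pi_(quotlmod S) v) - v \in S.
Proof. by rewrite -quotlmod_eq reprK. Qed.

Lemma quotlmod_eq0 (x : quotlmod S) : repr x \in S -> x = 0.
Proof.
move=> Sx; rewrite -[x]reprK; have -> : 0 = \pi_(quotlmod S) 0 by rewrite pi_zeror.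
by apply/eqP; rewrite quotlmod_eq subr0.
Qed.

Lemma quotlmod_iso_regular (f : V -> F) (v0 : V) :
  (forall a u v, f (a *: u + v) = a * f u + f v) ->
  (forall v, v \in S <-> f v = 0) -> f v0 <> 0 ->
  lmod_iso (quotlmod S) (F^o : lmodType F).
Proof.
move=> flin fker fv0.
have f0 : f 0 = 0 by have := flin (-1) 0 0; rewrite scaler0 addr0 mulN1r addNr.
have fB u v : f (u - v) = f u - f v.
  by rewrite -scaleN1r addrC flin mulN1r addrC.
pose g (x : quotlmod S) : F^o := f (repr x).
have gpi v : g (\pi_(quotlmod S) v) = f v.
  by apply/eqP; rewrite -subr_eq0 -fB; apply/eqP/fker/repr_quotlmod.
have glin : linear g.
  move=> a x y; rewrite -[in LHS](reprK x) -[in LHS](reprK y).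
  have -> : a *: \pi_(quotlmod S) (repr x) + \pi_(quotlmod S) (repr y)
      = \pi_(quotlmod S) (a *: repr x + repr y).
    rewrite quotlmod_piD; congr (_ + _); exact: quotlmod_scaleE.
  by rewrite gpi flin.
pose G : {linear quotlmod S -> F^o} :=
  HB.pack g (GRing.isLinear.Build F (quotlmod S) F^o *:%R g glin).
exists G; exists (fun c : F => \pi_(quotlmod S) ((c / f v0) *: v0)).
  move=> x; rewrite -[RHS]reprK; apply/eqP; rewrite quotlmod_eq.
  apply/fker; rewrite fB -[_ *: v0]addr0 flin f0 addr0 divfK ?subrr //.
  exact/eqP.
move=> c; rewrite /= gpi -[_ *: v0]addr0 flin f0 addr0 divfK //; exact/eqP.
Qed.

End QuotientLmodule.

Section Cohomology.
Variables (F : numFieldType) (L : lieAlgType F).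
Variables (b : nat -> L) (coord : nat -> L -> F).
Hypothesis coord_linear : forall i a x y,
  coord i (a *: x + y) = a * coord i x + coord i y.
Hypothesis coord_basis : forall i j, (i < dim_g)%N -> (j < dim_g)%N ->
  coord i (b j) = (i == j)%:R.
Hypothesis coordK : forall x, \sum_(i <- indices) coord i x *: b i = x.
Hypothesis lie_basis : forall i j, (i < dim_g)%N -> (j < dim_g)%N ->
  lie (b i) (b j) = \sum_(q <- bracket i j) zF F q.1 *: b q.2.
Local Notation M := (adjoint L).
Local Notation functional := (functional b coord).

Lemma fun_list_cochain k (w : ('I_k -> L) -> M) : fun_cochain (list_cochain w) = w.
Proof. by apply/funext => x; rewrite /fun_cochain /list_cochain nth_args. Qed.

Lemma list_fun_cochain k (W : seq L -> M) (s : seq L) :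
  size s = k -> list_cochain (@fun_cochain _ _ M k W) s = W s.
Proof. by move=> szs; rewrite /list_cochain /fun_cochain args_nth. Qed.

Lemma list_diffE k (w : ('I_k -> L) -> M) s : is_cochain w -> size s = k.+1 ->
  list_diff (list_cochain w) s = ce_diff w (fun i => nth 0 s i).
Proof.
move=> cow szs; rewrite -[in RHS](fun_list_cochain w) ce_diffE.
  by rewrite args_nth.
exact: alternating_list_cochain.
Qed.

Lemma is_coboundary_list k (w : ('I_k -> L) -> M) : is_cochain w ->
  is_coboundary w <->
  exists2 U : seq L -> M, alternating k.-1 U
    & forall s, size s = k -> list_cochain w s = list_diff U s.
Proof.
case: k w => [|k] w cow; split.
- move=> w0; exists (fun=> 0); first by [].
  by move=> [|//] _; rewrite /= w0.
- move=> [U _ dU]; apply/funext => x; rewrite -(fun_list_cochain w).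
  by rewrite /fun_cochain dU ?size_args // /args enum_ord0.
- move=> [u cou <-]; exists (list_cochain u); first exact: alternating_list_cochain.
  by move=> s szs; rewrite list_diffE.
- move=> [U altU dU]; exists (fun_cochain U); first exact: is_cochain_fun.
  apply/funext => x; rewrite (ce_diffE _ altU) -dU ?size_args //.
  by rewrite -[in RHS](fun_list_cochain w).
Qed.

Lemma functional_linear k a (W U : seq L -> M) :
  functional k (fun s => a *: W s + U s) = a * functional k W + functional k U.
Proof.
rewrite /functional /comb_eval mulr_sumr -big_split; apply: eq_bigr => q _ /=.
by rewrite /entry coord_linear mulrDr mulrCA.
Qed.

Lemma coboundaryP k (w : cocycle M k) :
  w \in coboundaries M k <-> functional k (list_cochain w) = 0.
Proof.
have /asboolP[cow dw] : cocycle_val w \in @cocycle_pred _ _ M k := valP w.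
have altW := alternating_list_cochain cow.
rewrite unfold_in; split=> [/asboolP/(is_coboundary_list cow)[U altU dU]|fw0].
  rewrite (eq_functional b coord dU).
  exact: (functional_list_diff coord_linear coord_basis coordK lie_basis altU).
apply/asboolP/(is_coboundary_list cow).
apply: (cocycle_decomposition coord_linear coord_basis coordK lie_basis altW _ fw0).
by move=> s szs; rewrite list_diffE // dw.
Qed.

Theorem cohomology_of_adapted_basis k :
  if k \in class_degrees then lmod_iso (cohomology M k) (F^o : lmodType F)
  else forall h : cohomology M k, h = 0.
Proof.
case: ifP => kdeg; last first.
  move=> h; apply: quotlmod_eq0; apply/coboundaryP.
  by apply: functional_other; rewrite kdeg.
have altZ : alternating k (class_cochain b coord k) by apply: alternating_of_coords.
have cozP : fun_cochain (class_cochain b coord k) \in @cocycle_pred _ _ M k.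
  apply/asboolP; split; first exact: is_cochain_fun.
  apply/funext => x; rewrite ce_diffE // class_cochainP ?size_args //.
pose z := Cocycle cozP.
apply: (@quotlmod_iso_regular _ _ (coboundaries M k)
  (fun w : cocycle M k => functional k (list_cochain w)) z).
- by move=> a u v; rewrite -functional_linear.
- exact: coboundaryP.
rewrite /= (eq_functional b coord (U := class_cochain b coord k)).
  by rewrite functional_class //; apply/eqP; rewrite expf_eq0 zF_eq0.
exact: list_fun_cochain.
Qed.
End Cohomology.

(** * Irreducible modules of sl_2 *)

Section SL2Basis.
Variable F : comNzRingType.
Local Notation sl2 := (sl F 2).

Fact sl2_e_traceless : \matrix_(i < 2, j < 2) ((i == 0) && (j == 1))%:R \in @traceless F 2.
Proof. by rewrite unfold_in /mxtrace !big_ord_recl big_ord0 !mxE /= !addr0. Qed.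
Definition sl2_e : sl2 := Sl sl2_e_traceless.

Fact sl2_f_traceless : \matrix_(i < 2, j < 2) ((i == 1) && (j == 0))%:R \in @traceless F 2.
Proof. by rewrite unfold_in /mxtrace !big_ord_recl big_ord0 !mxE /= !addr0. Qed.
Definition sl2_f : sl2 := Sl sl2_f_traceless.

Fact sl2_h_traceless : \matrix_(i < 2, j < 2) ((i == j)%:R * (-1) ^+ i) \in @traceless F 2.
Proof.
rewrite unfold_in /mxtrace !big_ord_recl big_ord0 !mxE /= expr0 expr1.
by rewrite !mul1r addr0 subrr.
Qed.
Definition sl2_h : sl2 := Sl sl2_h_traceless.

Lemma sl2_eq (A B : sl2) : slval A 0 0 = slval B 0 0 -> slval A 0 1 = slval B 0 1 ->
  slval A 1 0 = slval B 1 0 -> A = B.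
Proof.
have tr (C : sl2) : slval C 1 1 = - slval C 0 0.
  have := valP C; rewrite /= unfold_in /mxtrace !big_ord_recl big_ord0 addr0 addrC.
  rewrite addr_eq0 => /eqP <-; congr (slval C _ _); exact: val_inj.
move=> e00 e01 e10; apply: val_inj; apply/matrixP => i j /=.
have ord2 (l : 'I_2) : l = 0 \/ l = 1.
  by case: l => -[|[|//]] ltl; [left|right]; apply: val_inj.
by case: (ord2 i) (ord2 j) => -> [] ->; rewrite ?tr ?e00.
Qed.

Lemma lie_he : lie sl2_h sl2_e = 2 *: sl2_e.
Proof. by apply: sl2_eq; rewrite /= !mxE !big_ord_recl !big_ord0 !mxE /=; ring. Qed.
Lemma lie_hf : lie sl2_h sl2_f = -2 *: sl2_f.
Proof. by apply: sl2_eq; rewrite /= !mxE !big_ord_recl !big_ord0 !mxE /=; ring. Qed.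
Lemma lie_ef : lie sl2_e sl2_f = sl2_h.
Proof. by apply: sl2_eq; rewrite /= !mxE !big_ord_recl !big_ord0 !mxE /=; ring. Qed.

Lemma sl2_decomposition (A : sl2) :
  A = slval A 0 1 *: sl2_e + slval A 0 0 *: sl2_h + slval A 1 0 *: sl2_f.
Proof. by apply: sl2_eq; rewrite /= !mxE /=; ring. Qed.

End SL2Basis.

Section HighestWeight.
Import VectorInternalTheory.
Variables (F : numClosedFieldType) (V : lieModVectType (sl F 2)).
Local Notation e := (sl2_e F).
Local Notation h := (sl2_h F).
Local Notation f := (sl2_f F).
Implicit Types (u v : V).

Local Notation act := (@lie_act F (sl F 2) V).

Lemma act_linear_arg (x y : sl F 2) a v :
  act (a *: x + y) v = a *: act x v + act y v.
Proof. exact: lie_act_linearl. Qed.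

Lemma act0_arg v : act 0 v = 0.
Proof.
by have := act_linear_arg 0 0 (-1) v; rewrite scaler0 addr0 scaleN1r addNr.
Qed.

Lemma actZ_arg (x : sl F 2) a v : act (a *: x) v = a *: act x v.
Proof. by have := act_linear_arg x 0 a v; rewrite !addr0 act0_arg addr0. Qed.

Lemma actD_arg (x y : sl F 2) v : act (x + y) v = act x v + act y v.
Proof. by have := act_linear_arg x y 1 v; rewrite !scale1r. Qed.

Lemma act_he v : act h (act e v) = act e (act h v) + 2 *: act e v.
Proof. by rewrite -actZ_arg -lie_he lie_act_lie addrC subrK. Qed.

Lemma act_hf v : act h (act f v) = act f (act h v) - 2 *: act f v.
Proof. by rewrite -scaleNr -actZ_arg -lie_hf lie_act_lie addrC subrK. Qed.

Lemma act_ef v : act e (act f v) = act f (act e v) + act h v.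
Proof. by rewrite -(lie_ef F) lie_act_lie addrC subrK. Qed.

(** The matrix of x acting on row vectors, through the coordinates of V; it
    gives access to characteristic polynomials. *)
Definition act_mx (x : sl F 2) : 'M[F]_(dim V) :=
  \matrix_i v2r (act x (r2v (delta_mx 0 i))).

Lemma act_mxE x (u : 'rV[F]_(dim V)) : u *m act_mx x = v2r (act x (r2v u)).
Proof.
rewrite mulmx_sum_row {2}[u]row_sum_delta linear_sum.
rewrite (big_morph (act x) (lie_actDr x) (lie_act0r V x)) linear_sum.
apply: eq_bigr => i _; rewrite linearZ /= lie_actZr linearZ /=; congr (_ *: _).
by apply/rowP => j; rewrite !mxE.
Qed.

Definition is_weight (a : F) := eigenvalue (act_mx h) a.

Lemma is_weightP a :
  reflect (exists2 v, act h v = a *: v & v != 0) (is_weight a).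
Proof.
apply: (iffP eigenvalueP) => [[u]|[v hv v0]].
  rewrite act_mxE => hu u0; exists (r2v u).
    by apply: (can_inj v2rK); rewrite hu linearZ /= r2vK.
  by rewrite -(inj_eq (can_inj v2rK)) r2vK linear0.
exists (v2r v); first by rewrite act_mxE v2rK hv linearZ.
by rewrite -(inj_eq (can_inj r2vK)) v2rK linear0.
Qed.

(** Distinct eigenvalues of h are distinct roots of its characteristic
    polynomial. *)
Lemma weight_progression (a d : F) n : d != 0 ->
  (forall i, (i < n)%N -> is_weight (a + d *+ i)) -> (n <= dim V)%N.
Proof.
move=> d0 wt; have char0 : char_poly (act_mx h) != 0.
  by rewrite monic_neq0 // char_poly_monic.
rewrite -ltnS -(size_char_poly (act_mx h)) -(size_iota 0 n).
rewrite -(size_map (fun i => a + d *+ i)); apply: max_poly_roots => //.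
  rewrite all_map; apply/allP => i; rewrite mem_iota /= => lti.
  by rewrite -eigenvalue_root_char; apply: wt.
rewrite map_inj_uniq ?iota_uniq // => i j /addrI/eqP.
by rewrite -(mulr_natr d i) -(mulr_natr d j) (inj_eq (mulfI d0)) eqr_nat => /eqP.
Qed.

Let two0 : (2 : F) != 0. Proof. by rewrite pnatr_eq0. Qed.

(** If the weights were stable under adding 2 there would be infinitely many;
    so some weight a has a + 2 not a weight, and e kills its eigenvectors. *)
Lemma exists_highest_weight_vector : (0 < dim V)%N ->
  exists a v, [/\ v != 0, act h v = a *: v & act e v = 0].
Proof.
move=> dimV.
have [a0 wt0] : exists a, is_weight a.
  have /closed_rootP [a ra] : size (char_poly (act_mx h)) != 1%N.
    by rewrite size_char_poly; case: (dim V) dimV.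
  by exists a; rewrite /is_weight eigenvalue_root_char.
have [[a /is_weightP[v hv v0] nwt]|all_wt] :=
    pselect (exists2 a, is_weight a & ~~ is_weight (a + 2)).
  exists a, v; split=> //; apply/eqP; apply: contraNT nwt => ev0.
  apply/is_weightP; exists (act e v) => //.
  by rewrite act_he hv lie_actZr -scalerDl.
have : ((dim V).+1 <= dim V)%N; last by rewrite ltnn.
apply: (weight_progression (a := a0) two0) => i _.
elim: i => [|i IH]; first by rewrite addr0.
rewrite mulrSr addrA; case: (boolP (is_weight _)) => // nwt.
by case: all_wt; exists (a0 + 2 *+ i).
Qed.

(** Let u_i = f^i v for a highest weight vector v of weight a. The weights
    a - 2 i cannot all occur, so u_(n+1) = 0 for a first n; then
    0 = e u_(n+1) = (n + 1) (a - n) u_n forces a = n. The span of the u_i is a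
    submodule, hence V, so dim V <= n + 1; and n + 1 distinct weights need
    dim V >= n + 1. *)
Theorem sl2_weight_basis m : is_irr_sl2_module m V ->
  exists w : nat -> V,
  [/\ forall i, act h (w i) = (m%:R - 2 * i%:R) *: w i,
      act e (w 0%N) = 0,
      forall i, act e (w i.+1) = (m%:R - i%:R) *: w i,
      forall i, act f (w i) = i.+1%:R *: w i.+1
    & w m.+1 = 0 /\ basis_of fullv (mkseq w m.+1)].
Proof.
case=> -[_ irr]; rewrite dimvf => dimV.
have [|a [v [v0 hv ev]]] := exists_highest_weight_vector; first by rewrite dimV.
pose u i := iter i (act f) v.
have hu i : act h (u i) = (a - 2 * i%:R) *: u i.
  elim: i => [|i IH]; first by rewrite mulr0 subr0.
  rewrite /= act_hf -/(u i) IH lie_actZr -scalerBl; congr (_ *: _).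
  rewrite -(natr1 i); ring.
have eu i : act e (u i.+1) = (i.+1%:R * (a - i%:R)) *: u i.
  elim: i => [|i IH].
    by rewrite /= act_ef ev lie_act0r add0r hv subr0 mul1r.
  rewrite [u i.+2]/= act_ef -/(u i.+1) IH lie_actZr -[act f (u i)]/(u i.+1) hu.
  rewrite -scalerDl; congr (_ *: _); rewrite -!natr1; ring.
have wt_u i : u i != 0 -> is_weight (a + (-2) *+ i).
  move=> u0; apply/is_weightP; exists (u i) => //.
  by rewrite hu -[(-2) *+ i]mulr_natr mulNr.
have [n [un0 ltn]] : exists n, u n = 0 /\ forall i, (i < n)%N -> u i != 0.
  have ex : exists n, u n == 0.
    apply: contrapT => nu; have : ((dim V).+1 <= dim V)%N; last by rewrite ltnn.
    apply: (@weight_progression a (-2)); first by rewrite oppr_eq0.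
    by move=> i _; apply: wt_u; apply/negP => ui0; apply: nu; exists i.
  exists (ex_minn ex); case: ex_minnP => n /eqP un0 minn; split=> // i ltin.
  by apply: contraL ltin => /minn; rewrite -leqNgt.
have fact0 i : (i`!%:R : F) != 0 by rewrite pnatr_eq0 -lt0n fact_gt0.
case: n un0 ltn => [|n] un0 ltn; first by rewrite /= in un0; rewrite un0 eqxx in v0.
have an : a = n%:R.
  have := eu n; rewrite un0 lie_act0r => /esym/eqP; rewrite scaler_eq0.
  by rewrite (negbTE (ltn n _)) // orbF mulf_eq0 pnatr_eq0 /= subr_eq0 => /eqP.
have le_nm : (n.+1 <= dim V)%N.
  apply: (@weight_progression a (-2)); first by rewrite oppr_eq0.
  by move=> i /ltn; apply: wt_u.
pose w i := (i`!%:R)^-1 *: u i.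
have hw i : act h (w i) = (n%:R - 2 * i%:R) *: w i.
  by rewrite lie_actZr hu scalerA mulrC -scalerA an.
have ew i : act e (w i.+1) = (n%:R - i%:R) *: w i.
  rewrite lie_actZr eu scalerA -an scalerA; congr (_ *: _).
  by rewrite factS natrM; field; rewrite fact0 nat1r pnatr_eq0.
have ew0 : act e (w 0%N) = 0 by rewrite lie_actZr ev scaler0.
have fw i : act f (w i) = i.+1%:R *: w i.+1.
  rewrite lie_actZr scalerA -/(u i.+1); congr (_ *: _).
  by rewrite factS natrM; field; rewrite fact0 nat1r pnatr_eq0.
have wn0 : w n.+1 = 0 by rewrite /w un0 scaler0.
pose W := <<mkseq w n.+1>>%VS.
have memW i : (i < n.+1)%N -> w i \in W.
  by move=> lti; apply/memv_span/map_f; rewrite mem_iota.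
have stabW : lie_stable W.
  move=> x y yW; rewrite (coord_span (X := in_tuple (mkseq w n.+1)) yW).
  rewrite (big_morph (act x) (lie_actDr x) (lie_act0r V x)); apply: memv_suml => i _.
  rewrite lie_actZr; apply: memvZ.
  have lti : (i < n.+1)%N by have := ltn_ord i; rewrite [X in (_ < X)%N -> _]size_mkseq.
  move: (nat_of_ord i) lti => {i yW} i lti.
  rewrite nth_mkseq // (sl2_decomposition x) !actD_arg !actZ_arg.
  have We : act e (w i) \in W.
    by case: i lti => [|i] lti; rewrite ?ew0 ?mem0v // ew memvZ // memW // ltnW.
  have Wh : act h (w i) \in W by rewrite hw memvZ // memW.
  have Wf : act f (w i) \in W.
    rewrite fw memvZ //; have [->|neq_in] := eqVneq i n; first by rewrite wn0 mem0v.
    by apply: memW; rewrite ltnS ltn_neqAle neq_in.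
  by rewrite !memvD // memvZ.
have Wfull : W = fullv.
  have [W0|//] := irr W stabW; have := memW 0 isT; rewrite W0 memv0.
  by rewrite scaler_eq0 invr_eq0 (negbTE (fact0 0)) (negbTE v0).
have nm : n = m.
  apply/eqP; rewrite -eqSS eqn_leq -{1}dimV le_nm /= -dimV -dimvf -Wfull.
  by rewrite (leq_trans (dim_span _)) ?size_mkseq.
subst n; exists w; split=> //; split=> //.
by rewrite basisEdim size_mkseq dimvf dimV -Wfull subvv /=.
Qed.
End HighestWeight.

(** * The adapted basis of the semidirect product *)

Section AdaptedBasis.
Variables (F : numClosedFieldType) (V : lieModVectType (sl F 2)).
Variable w : nat -> V.
Local Notation g := (semidirect V).
Local Notation act := (@lie_act F (sl F 2) V).

Definition sl2_basis (i : nat) : sl F 2 :=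
  match i with 0 => sl2_e F | 1 => sl2_h F | _ => sl2_f F end.

Definition sl2_coord (i : nat) (A : sl F 2) : F :=
  match i with 0 => slval A 0 1 | 1 => slval A 0 0 | _ => slval A 1 0 end.

Definition g_basis (i : nat) : g :=
  if (i < 3)%N then (sl2_basis i, 0) else (0, w (i - 3)).

Definition g_coord (i : nat) (x : g) : F :=
  if (i < 3)%N then sl2_coord i x.1
  else coord (in_tuple (mkseq w 6)) (inord (i - 3)) x.2.

Section Coordinates.
Hypothesis w_basis : basis_of fullv (mkseq w 6).

Lemma g_coord_linear i a (x y : g) :
  g_coord i (a *: x + y) = a * g_coord i x + g_coord i y.
Proof.
rewrite /g_coord; case: ifP => [_|_]; last by rewrite linearP.
by rewrite /sl2_coord; case: i => [|[|i]]; rewrite /= !mxE.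
Qed.

Lemma sl2_coord_basis i j : (i < 3)%N -> (j < 3)%N ->
  sl2_coord i (sl2_basis j) = (i == j)%:R.
Proof.
by move: i j => [|[|[|//]]] [|[|[|//]]] _ _; rewrite /sl2_coord /= !mxE /= ?mulr1 ?mul0r.
Qed.

Lemma g_coord_basis i j : (i < dim_g)%N -> (j < dim_g)%N ->
  g_coord i (g_basis j) = (i == j)%:R.
Proof.
move=> lti ltj; rewrite /g_coord /g_basis; case: ifP => i3; case: ifP => j3.
- exact: sl2_coord_basis.
- have -> : (i == j) = false by apply/eqP => ij; rewrite ij j3 in i3.
  by rewrite /sl2_coord /=; case: i {lti i3} => [|[|i]]; rewrite mxE.
- have -> : (i == j) = false by apply/eqP => ij; rewrite ij j3 in i3.
  by rewrite linear0.
rewrite /dim_g in lti ltj; have lti' : (i - 3 < 6)%N by lia.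
have ltj' : (j - 3 < 6)%N by lia.
have := coord_free (X := in_tuple (mkseq w 6)) (inord (j - 3)) (inord (i - 3))
  (basis_free w_basis).
rewrite inordK // (nth_mkseq 0 w ltj' : (in_tuple _)`_(j - 3) = _) => ->.
congr (nat_of_bool _)%:R.
by rewrite -(inj_eq val_inj) /= !inordK // eq_sym; apply/eqP/eqP; lia.
Qed.

Lemma g_coordK (x : g) : \sum_(i <- indices) g_coord i x *: g_basis i = x.
Proof.
case: x => A v; apply: injective_projections.
  rewrite (big_morph (fun x : g => x.1) (fun _ _ => erefl) erefl).
  rewrite /indices /= !big_cons big_nil /= !scaler0 !addr0 addrA.
  by rewrite -sl2_decomposition.
rewrite (big_morph (fun x : g => x.2) (fun _ _ => erefl) erefl).
rewrite /= [RHS](coord_basis (X := in_tuple (mkseq w 6)) w_basis (memvf v)).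
rewrite (eq_bigr (fun i : 'I_6 => coord (in_tuple (mkseq w 6)) (inord i) v *: w i)).
  rewrite -(big_mkord predT (fun i => coord (in_tuple (mkseq w 6)) (inord i) v *: w i)).
  by rewrite /indices /index_iota /= !big_cons !big_nil /= !scaler0 !add0r.
by move=> i _; rewrite (nth_mkseq 0 w (ltn_ord i) : (in_tuple _)`_i = _) inord_val.
Qed.

End Coordinates.

Section Brackets.
Hypothesis hw : forall i, act (sl2_h F) (w i) = (5%:R - 2 * i%:R) *: w i.
Hypothesis ew0 : act (sl2_e F) (w 0%N) = 0.
Hypothesis ew : forall i, act (sl2_e F) (w i.+1) = (5%:R - i%:R) *: w i.
Hypothesis fw : forall i, act (sl2_f F) (w i) = i.+1%:R *: w i.+1.
Hypothesis w6 : w 6%N = 0.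

Lemma sl2_actionE i m : (i < 3)%N -> (m < 6)%N ->
  \sum_(q <- sl2_action i m) zF F q.1 *: w q.2 = act (sl2_basis i) (w m).
Proof.
have zF5 : zF F 5%Z = 5%:R := zFnat F 5; have zF2 : zF F 2%Z = 2%:R := zFnat F 2.
move: i => [|[|[|//]]] _ ltm.
- case: m ltm => [|m] ltm; first by rewrite big_nil ew0.
  rewrite big_seq1 -[_.1]/(Z.sub 5 (Z.of_nat m)) -[_.2]/m.
  by rewrite zFB zFnat zF5 ew.
- rewrite big_seq1 -[_.1]/(Z.sub 5 (Z.mul 2 (Z.of_nat m))) -[_.2]/m.
  by rewrite zFB zFM zFnat zF5 zF2 hw.
- rewrite /=; case: ifP => [_|m5].
    by rewrite big_seq1 -[_.1]/(Z.of_nat m.+1) -[_.2]/m.+1 zFnat fw.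
  have m_5 : m = 5%N by lia.
  by rewrite m_5 big_nil fw w6 scaler0.
Qed.

Lemma sl2_bracketE i j : (i < 3)%N -> (j < 3)%N ->
  \sum_(q <- sl2_bracket i j) zF F q.1 *: sl2_basis q.2
    = lie (sl2_basis i) (sl2_basis j).
Proof.
have lie_he := lie_he F; have lie_hf := lie_hf F; have lie_ef := lie_ef F.
move: i j => [|[|[|//]]] [|[|[|//]]] _ _; rewrite /= ?big_seq1 ?big_nil ?lie_alt //=.
- by rewrite lie_anti lie_he -scaleNr.
- by rewrite lie_ef scale1r.
- by rewrite lie_anti lie_ef scaleN1r.
- by rewrite lie_anti lie_hf -scaleNr opprK.
Qed.

Lemma sum_g_basis_sl2 (r : seq (Z * nat)) (c : Z * nat -> F) :
  all (fun q => q.2 < 3)%N r ->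
  \sum_(q <- r) c q *: g_basis q.2 = (\sum_(q <- r) c q *: sl2_basis q.2, 0).
Proof.
elim: r => [|q r IH] /=; first by rewrite !big_nil.
case/andP=> ltq /IH {}IH; rewrite !big_cons IH /g_basis ltq.
by congr pair; rewrite /= ?scaler0 ?addr0.
Qed.

Lemma sum_g_basis_V (r : seq (Z * nat)) (c : Z * nat -> F) :
  \sum_(q <- r) c q *: g_basis (q.2 + 3) = (0, \sum_(q <- r) c q *: w q.2).
Proof.
elim: r => [|q r IH]; first by rewrite !big_nil.
rewrite !big_cons IH /g_basis ltnNge leq_addl addnK.
by congr pair; rewrite /= ?scaler0 ?addr0.
Qed.

Lemma g_lie_basis i j : (i < dim_g)%N -> (j < dim_g)%N ->
  lie (g_basis i) (g_basis j) = \sum_(q <- bracket i j) zF F q.1 *: g_basis q.2.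
Proof.
rewrite /dim_g => lti ltj.
have lie_g (x y : g) : lie x y = (lie x.1 y.1, act x.1 y.2 - act y.1 x.2) by [].
have lie0r A : lie A 0 = 0 :> sl F 2.
  by apply: (addrI (lie A 0)); rewrite -lieDr !addr0.
have lie0l A : lie 0 A = 0 :> sl F 2 by rewrite lie_anti lie0r oppr0.
rewrite lie_g /bracket; case: ifP => i3; case: ifP => j3.
- rewrite sum_g_basis_sl2; last by move: i j i3 j3 {lti ltj} => [|[|[|//]]] [|[|[|//]]].
  by rewrite sl2_bracketE // /g_basis i3 j3 /= !(lie_act0r V) subrr.
- rewrite big_map (sum_g_basis_V _ (fun q => zF F q.1)) sl2_actionE; [|by []|by lia].
  by rewrite /g_basis i3 j3 /= lie0r (act0_arg 0) subr0.
- rewrite big_map (eq_bigr (fun q => (- zF F q.1) *: g_basis (q.2 + 3))); last first.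
    by move=> q _; rewrite zFN.
  rewrite (sum_g_basis_V _ (fun q => - zF F q.1)).
  rewrite (eq_bigr (fun q => - (zF F q.1 *: w q.2))); last by move=> q _; rewrite scaleNr.
  rewrite sumrN sl2_actionE; [|by []|by lia].
  by rewrite /g_basis i3 j3 /= lie0l (act0_arg 0) sub0r.
- by rewrite big_nil /g_basis i3 j3 /= lie0r !act0_arg subrr.
Qed.

End Brackets.

End AdaptedBasis.

Theorem proposition4p4 (R : realType) (V : lieModVectType (sl R[i] 2))
    (hV : is_irr_sl2_module 5 V) (k : nat) :
  let g := semidirect V in
  let Hk := cohomology (adjoint g) k in
  if k \in [:: 1; 3; 4; 5; 6; 8]%N then lmod_iso Hk (R[i]^o)
  else forall h : Hk, h = 0.
Proof.
have [w [hw ew0 ew fw [w6 w_basis]]] := sl2_weight_basis hV.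
exact: (cohomology_of_adapted_basis (g_coord_linear w) (g_coord_basis w_basis)
  (g_coordK w_basis) (g_lie_basis hw ew0 ew fw w6)).
Qed.
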